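(* Let $A=\Bbbk[x_1,\ldots,x_n]$ be a polynomial ring over a field $\Bbbk$ and let $t$ be a positive integer or $\infty$. Let $\mathfrak{a}$ be a monomial $A$-ideal with $\mathfrak{a}_1=0$ such that $x_i^t\in\mathfrak{a}$ for all $1\le i\le n$, and let $R=A/\mathfrak{a}$. Let $B=A[z]$, where $z$ is an indeterminate. If $\mathcal{H}_R$ admits an embedding, then $\mathcal{H}_{B/(\mathfrak{a}B,z^t)}$ admits an embedding. (Here $x_i^\infty=z^\infty=0$.)
   Context: $\mathbb{N}$ is the set of non-negative integers. For a standard graded $\Bbbk$-algebra $R=\bigoplus_{d\ge0}R_d$ ($R_0=\Bbbk$, $R=\Bbbk[R_1]$, $\dim_\Bbbk R_1<\infty$), $\mathcal{I}_R$ is the set of homogeneous ideals of $R$, partially ordered by inclusion; $H_I(\mathfrak{z})=\sum_{d\in\mathbb{N}}(\dim_\Bbbk I_d)\mathfrak{z}^d\in\mathbb{Z}[[\mathfrak{z}]]$ is the Hilbert series of $I\in\mathcal{I}_R$; $\mathcal{H}_R=\{H_J: J\in\mathcal{I}_R\}$, partially ordered coefficientwise. $\mathcal{H}_R$ admits an embedding (into $\mathcal{I}_R$) if there is an order-preserving injective map $\epsilon:\mathcal{H}_R\to\mathcal{I}_R$ with $H_{\epsilon(H)}=H$ for all $H\in\mathcal{H}_R$. $A$, $B$ and their quotients are standard graded, with all variables (including $z$) of degree $1$. *)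

(* Defs.v *)
From HB Require Import structures.
From mathcomp Require Import all_boot all_order all_algebra.
From mathcomp Require Import boolp classical_sets.
From mathcomp Require Import mpoly.

Set Implicit Arguments.
Unset Strict Implicit.
Unset Printing Implicit Defensive.

Import GRing.Theory.
Local Open Scope ring_scope.
Local Open Scope classical_set_scope.
Local Open Scope quotient_scope.

(* ring_quotient makes {ideal_quot I} a commutative ring; when the ambient ring
   is a commutative k-algebra, so is the quotient. *)
Section QuotientAlgebra.
Variables (k : comNzRingType) (A : comAlgType k) (I : idealr A).
Local Notation Q := {ideal_quot I}.

Definition quot_scale (c : k) (u : Q) : Q := \pi_Q (c *: repr u).

Lemma pi_scale c (f : A) : quot_scale c (\pi_Q f) = \pi_Q (c *: f).
Proof.
apply/eqP; rewrite -Quotient.idealrBE -scalerBr -mulr_algl.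
by rewrite idealMr // Quotient.idealrBE reprK.
Qed.

Lemma quot_scaleA b c u : quot_scale b (quot_scale c u) = quot_scale (b * c) u.
Proof.
by rewrite -[u]reprK [quot_scale c _]pi_scale !pi_scale scalerA.
Qed.

Lemma quot_scale1 : left_id 1 quot_scale.
Proof. by move=> u; rewrite -[u]reprK pi_scale scale1r. Qed.

Lemma quot_scaleDr : right_distributive quot_scale +%R.
Proof.
move=> c u v; rewrite -[u]reprK -[v]reprK -rmorphD !pi_scale scalerDr.
by rewrite rmorphD.
Qed.

Lemma quot_scaleDl u : {morph quot_scale^~ u : b c / b + c}.
Proof. by move=> b c; rewrite -[u]reprK !pi_scale scalerDl rmorphD. Qed.

HB.instance Definition _ := GRing.Zmodule_isLmodule.Build k Q
  quot_scaleA quot_scale1 quot_scaleDr quot_scaleDl.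

Lemma quot_scaleAl (c : k) (u v : Q) : c *: (u * v) = (c *: u) * v.
Proof.
have scale_pi f : c *: (\pi_Q f : Q) = \pi_Q (c *: f) by exact: pi_scale.
by rewrite -[u]reprK -[v]reprK -rmorphM !scale_pi -rmorphM scalerAl.
Qed.

HB.instance Definition _ := GRing.Lmodule_isLalgebra.Build k Q quot_scaleAl.
HB.instance Definition _ := GRing.Lalgebra_isComAlgebra.Build k Q.

End QuotientAlgebra.

(* Unlike idealr, the whole ring is allowed here. *)
Definition is_ideal (R : comNzRingType) (J : set R) : Prop :=
  J 0 /\ forall a u v, J u -> J v -> J (a * u + v).

Definition ideal_gen (R : comNzRingType) (G : set R) : set R :=
  smallest (@is_ideal R) G.

Section GradedAlgebra.
Variables (k : fieldType) (R : comAlgType k).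

Definition is_basis (V : set R) m (e : 'I_m -> R) : Prop :=
  [/\ forall i, V (e i),
      forall c : 'I_m -> k, \sum_i c i *: e i = 0 -> forall i, c i = 0
    & forall v, V v -> exists c : 'I_m -> k, v = \sum_i c i *: e i].

(* Only meaningful for finite-dimensional subspaces (0 by default otherwise). *)
Definition kdim (V : set R) : nat :=
  xget 0%N [set m | exists e : 'I_m -> R, is_basis V e].

Variable gr : nat -> set R. (* the graded pieces R_d *)

Definition is_homog_ideal (J : set R) : Prop :=
  is_ideal J /\
  forall f, J f -> exists d (g : 'I_d -> R),
    (forall i : 'I_d, (J `&` gr i) (g i)) /\ f = \sum_i g i.

(* A power series is represented by its sequence of coefficients. *)
Definition hilb (J : set R) : nat -> nat := fun d => kdim (J `&` gr d).

Definition hilb_series : set (nat -> nat) :=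
  [set H | exists2 J, is_homog_ideal J & hilb J = H].

Definition le_series (H H' : nat -> nat) : Prop := forall d, (H d <= H' d)%N.

(* The embedding is a total function whose values outside hilb_series are
   irrelevant. *)
Definition admits_embedding : Prop :=
  exists eps : (nat -> nat) -> set R,
    [/\ forall H, hilb_series H -> is_homog_ideal (eps H),
        forall H H', hilb_series H -> hilb_series H' ->
          le_series H H' -> eps H `<=` eps H',
        forall H H', hilb_series H -> hilb_series H' ->
          eps H = eps H' -> H = H'
      & forall H, hilb_series H -> hilb (eps H) = H].

End GradedAlgebra.

Section MonomialQuotient.
Variables (k : fieldType) (n : nat).
Local Notation A := {mpoly k[n]}.
Local Notation B := {mpoly k[n.+1]}. (* A[z], with z = 'X_ord_max *)

Definition quot_gr (a : idealr A) (d : nat) : set {ideal_quot a} :=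
  [set \pi_{ideal_quot a} f | f in [set f : A | f \is d.-homog]].

Definition is_monomial_ideal (a : set A) : Prop :=
  exists M : set 'X_{1..n},
    a = ideal_gen [set 'X_[m] | m in M].

(* t = None stands for t = oo *)
Definition pos_exponent (t : option nat) : Prop :=
  if t is Some e then (0 < e)%N else True.

Definition exprt (R : nzRingType) (x : R) (t : option nat) : R :=
  if t is Some e then x ^+ e else 0.

Definition ext_set (a : set A) (t : option nat) : set B :=
  ideal_gen
    ([set mwiden f | f in a] `|` [set exprt 'X_ord_max t]).

(* The ideal (aB, z^t) of B. The positivity of t makes it a proper ideal, as
   required by idealr. *)
Definition ext_pred (a : idealr A) (t : option nat) (t_gt0 : pos_exponent t)
  : {pred B} := fun f => `[< ext_set [set` a] t f >].

Definition z_to_0_var (i : 'I_n.+1) : A :=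
  if unlift ord_max i is Some j then 'X_j else 0.

Local Notation z_to_0 := (mmap (@mpolyC n k) z_to_0_var).

Lemma z_to_0_mwiden (p : A) : z_to_0 (mwiden p) = p.
Proof.
rewrite [RHS](mpolyE p) [X in mwiden X](mpolyE p).
rewrite (raddf_sum (@mwiden n k)) (raddf_sum z_to_0); apply: eq_bigr => m _ /=.
rewrite mwidenZ mwidenX mmapZ mmapX mul_mpolyC; congr (_ *: _).
rewrite /mmap1 big_ord_recr /= mnmwiden_ordmax expr0 mulr1 mpolyXE_id.
apply: eq_bigr => i _; rewrite mnmwiden_widen /z_to_0_var.
have -> : widen_ord (leqnSn n) i = lift ord_max i.
  by apply/val_inj; rewrite [RHS]lift_max.
by rewrite liftK.
Qed.

Lemma z_to_0_z : z_to_0 'X_ord_max = 0.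
Proof. by rewrite mmapX mmap1U /z_to_0_var unlift_none. Qed.

Section Extension.
Variables (a : idealr A) (t : option nat) (t_gt0 : pos_exponent t).

Fact ext_idealr_closed : idealr_closed (ext_pred a t_gt0).
Proof.
split=> [||f u v /asboolP u_ext /asboolP v_ext].
- by apply/asboolP => J [[]].
- apply/asboolPn => /(_ [set f | z_to_0 f \in a]) /=.
  rewrite rmorph1 idealr1 => H; suff: false by []; apply: H; split.
    split=> [|f u v /= ua va]; first by rewrite /= rmorph0 rpred0.
    by rewrite rmorphD rmorphM rpredD // idealMr.
  move=> f /= [[g ga <-]|->]; first by rewrite z_to_0_mwiden.
  case: t t_gt0 => [e|_] /=; last by rewrite rmorph0 rpred0.
  move=> e_gt0; rewrite rmorphXn /= z_to_0_z expr0n.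
  by rewrite -[e == _]negbK -lt0n e_gt0 rpred0.
apply/asboolP => J JP; case: (JP) => -[_ J_closed] _.
exact: J_closed (u_ext J JP) (v_ext J JP).
Qed.

HB.instance Definition _ := isIdealr.Build B (ext_pred a t_gt0) ext_idealr_closed.

Definition ext_ideal : idealr B := ext_pred a t_gt0.

End Extension.
End MonomialQuotient.

Arguments quot_gr {k n} a d.

(* Main.v *)
Require Import Defs.
From mathcomp Require Import all_boot all_order all_algebra.
From mathcomp Require Import boolp classical_sets.
From mathcomp Require Import mpoly.
From mathcomp Require Import zify.

Set Implicit Arguments.
Unset Strict Implicit.
Unset Printing Implicit Defensive.

(** Let S = B/(aB, z^t). An embedding of the Hilbert functions of R amounts to a
    choice, in every degree e, of a flag of subspaces L e h of R_e, one of each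
    dimension h, such that R_1 (L e h) lies in L (e+1) (g e h), where g e h is
    the smallest number of nonzero multiples in degree e+1 that a set of h
    nonzero monomials of degree e can have ([embedding_flags]). Indeed the
    degree e part of the embedded ideal depends only on the value of the Hilbert
    function at e, since the ideal can be compared with one that vanishes below
    e and is everything above e.

    The task is to build such flags for S. In degree d take the direct sums of
    the spaces L (d-j) (p j) z^j over j <= d, j < t, for suitable vectors p.
    Call p stable when g (d-j-1) (p (j+1)) <= p j, that is, when R_1 times the
    coefficient space of z^(j+1) lies in that of z^j. Multiplying a stable sum
    by S_1 gives the sum attached to the shifted vector
    (g d (p 0), p 0, p 1, ...), cut off at t. Among the stable vectors there is
    a chain, the segments, playing the part of the lex segments: there is one of
    each total ([segment_exists]), any two are comparable
    ([segment_total]), a segment has the least growth among the stable vectors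
    of its total ([segment_min_growth]), and the shift of a segment is a segment
    ([shift_segment]). So the sums attached to segments form an ideal as soon as
    their dimensions H d satisfy: some stable vector of total H d has a shift of
    total at most H (d+1).

    It remains to see that the Hilbert function of an ideal J of S has this
    property ([hilb_stable]). Passing to leading monomials replaces J by
    a set of monomials. Write a monomial of degree d as u z^(d-|u|); then u alone
    codes it. For each variable x_i, cut the monomials of degree d into fibres
    along which only the exponents of x_i and z vary; replace the part
    of the set in each fibre by equally many monomials with the largest exponents
    of x_i. Since x_i^t is in a, a nonzero power of x_i has exponent less than t,
    so in a fibre the bound on the exponent of x_i is at most the one on z.
    That is what makes the operation compatible with multiplication by the
    variables ([compress_shadow]); it keeps the number of monomials and does not
    increase the sum of the z-exponents ([compress_weight]). Repeating it leads
    to a set that is stable under replacing z by any x_i ([exists_xstable]), and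
    the numbers of its elements with given z-exponent form a stable vector. *)

(** * Stable vectors and their segments *)

Definition below (t : option nat) (j : nat) : bool :=
  if t is Some e then j < e else true.

Lemma below_leq t i j : i <= j -> below t j -> below t i.
Proof. by case: t => //= e; lia. Qed.

Section StableVectors.
Variables (t : option nat) (D : nat -> nat) (g : nat -> nat -> nat).
Hypothesis g0 : forall e, g e 0 = 0.
Hypothesis g_mono : forall e h h', h <= h' -> h' <= D e -> g e h <= g e h'.
Hypothesis g_le : forall e h, h <= D e -> g e h <= D e.+1.

Definition cap d j := if (j <= d) && below t j then D (d - j) else 0.

(** p j stands for the dimension of the coefficient space of z^j in degree d;
    it vanishes for j > d and for j >= t. *)
Definition stable d (p : nat -> nat) :=
  (forall j, p j <= cap d j) /\ (forall j, g (d - j.+1) (p j.+1) <= p j).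

(** Lex segments without an order on the basis: an entry p i can only be
    nonzero when all later entries are at least as large as stability would let
    them be if that entry were p i - 1. The reference to every stable q avoids iterating
    the adjoint of g, and makes comparisons immediate. *)
Definition segment d (p : nat -> nat) :=
  stable d p /\
  forall q, stable d q -> forall i, q i < p i -> forall j, i <= j -> q j <= p j.

Definition total d (p : nat -> nat) := \sum_(j < d.+1) p j.

(** The vector of S_1 P when P is the sum attached to a stable vector p: for
    j > 0 the coefficient space of z^j is the larger of R_1 L (p j) and L (p (j-1)),
    which is the latter by stability. *)
Definition shift d (p : nat -> nat) j :=
  if j is j'.+1 then if below t j then p j' else 0 else g d (p 0).

Lemma cap_out d j : ~~ ((j <= d) && below t j) -> cap d j = 0.
Proof. by rewrite /cap => /negPf ->. Qed.

Lemma stable_cap d p j : stable d p -> p j <= D (d - j).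
Proof. by case=> /(_ j) + _; rewrite /cap; case: ifP => // _; lia. Qed.

Lemma stable_out d p j : stable d p -> ~~ ((j <= d) && below t j) -> p j = 0.
Proof. by move=> pS /cap_out cap0; apply/eqP; rewrite -leqn0 -cap0 pS.1. Qed.

Lemma total_mono d p q : (forall j, p j <= q j) -> total d p <= total d q.
Proof. by move=> le_pq; apply: leq_sum. Qed.

Lemma total_strict d p q i :
  (forall j, p j <= q j) -> i <= d -> p i < q i -> total d p < total d q.
Proof.
move=> le_pq; rewrite -ltnS => i_d lt_pq.
rewrite /total (bigD1 (Ordinal i_d)) //= [ltnRHS](bigD1 (Ordinal i_d)) //=.
by rewrite -addSn leq_add // leq_sum.
Qed.

Lemma stable_lt_idx d p q i : stable d q -> p i < q i -> i <= d.
Proof.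
move=> qS lt_pq; case: (leqP i d) => // d_i.
by move: lt_pq; rewrite (stable_out qS) // leqNgt d_i.
Qed.

Lemma segment_lt d p q i : stable d p -> segment d q -> p i < q i ->
  (forall j, j < i -> p j = q j) -> forall j, p j <= q j.
Proof.
move=> pS [_ qP] lt_pq eq_pq j.
by case: (ltnP j i) => [/eq_pq ->//|]; apply: qP lt_pq _.
Qed.

(** At the first index where they differ, the larger segment dominates the
    other vector from there on. *)
Lemma segment_total d p q : segment d p -> segment d q ->
  (forall j, p j <= q j) \/ (forall j, q j <= p j).
Proof.
move=> pP qP.
have [eq_pq|/existsNP [i0 /eqP i0P]] := pselect (forall j, p j = q j).
  by left=> j; rewrite eq_pq.
have exi: exists i, p i != q i by exists i0.
case: (ex_minnP exi) => i; rewrite neq_ltn => /orP lt_pq min_i.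
have eq_pq j : j < i -> p j = q j.
  by move=> lt_ji; apply/eqP; apply: contraTT lt_ji => /min_i; rewrite -leqNgt.
case: lt_pq => lt_pq.
  by left; apply: (@segment_lt d p q i) => //; case: pP.
right; apply: (@segment_lt d q p i) => //; first by case: qP.
by move=> j /eq_pq.
Qed.

Lemma segment_mono d p q : segment d p -> segment d q ->
  total d p <= total d q -> forall j, p j <= q j.
Proof.
move=> pP qP le_pq; case: (segment_total pP qP) => // le_qp j.
case: leqP => // lt_qp; have j_d := stable_lt_idx pP.1 lt_qp.
by have := total_strict le_qp j_d lt_qp; lia.
Qed.

Lemma segment0 d : segment d (fun=> 0).
Proof. by split=> //; split=> // j; rewrite g0. Qed.

Lemma cap_next d j h : j.+1 <= d -> below t j.+1 ->
  h <= cap d j.+1 -> g (d - j.+1) h <= cap d j.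
Proof.
move=> j_d tj; rewrite /cap j_d tj (ltnW j_d) (below_leq _ tj) //= => h_le.
by have := g_le h_le; rewrite -subSn // subSS.
Qed.

(** Increase the entry of largest index for which the result is still stable.
    No later entry can be increased, so the later entries are already maximal
    given the one before them, which is what a segment requires. *)
Lemma segment_succ d p : segment d p -> total d p < total d (cap d) ->
  exists2 q, segment d q & total d q = (total d p).+1.
Proof.
move=> [pS pP] lt_p.
(* ok j: the entry j can be increased. *)
pose ok j := (p j < cap d j) &&
  (if j is j'.+1 then g (d - j) (p j).+1 <= p j' else true).
have ok_d j : ok j -> j <= d.
  case/andP=> + _; case: (leqP j d) => // d_j; rewrite cap_out //.
  by rewrite leqNgt d_j.
have ex_ok: exists j, ok j.
  have exj: exists j, p j < cap d j.
    apply: contrapT => nex; move: lt_p; rewrite ltnNge => /negP; apply.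
    apply: total_mono => j; rewrite leqNgt; apply/negP => lt_j.
    by apply: nex; exists j.
  case: (ex_minnP exj) => -[|j] lt_j min_j; first by exists 0; rewrite /ok lt_j.
  exists j.+1; rewrite /ok lt_j /=.
  have [j_d tj]: j.+1 <= d /\ below t j.+1.
    by move: lt_j; rewrite /cap; case: ifP => // /andP[].
  have -> : p j = cap d j.
    apply/eqP; rewrite eqn_leq pS.1 leqNgt /=; apply/negP => /min_j.
    by rewrite ltnn.
  exact: cap_next.
case: (ex_maxnP ex_ok ok_d) => j /andP[lt_j okj] max_j.
pose q l := p l + (l == j).
have le_pq l : p l <= q l by apply: leq_addr.
have qS : stable d q.
  split=> [l|l]; rewrite /q.
    by case: eqP => [->|_]; rewrite ?addn1 ?addn0 // pS.1.
  case: (l.+1 =P j) => [jE|_].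
    by rewrite addn1; apply: leq_trans (leq_addr _ _); rewrite -jE in okj.
  by rewrite addn0; apply: leq_trans (pS.2 l) (leq_addr _ _).
exists q; last first.
  have jd: j < d.+1 by rewrite ltnS; apply: ok_d; rewrite /ok lt_j.
  rewrite /total big_split /= -[RHS]addn1; congr (_ + _).
  rewrite (bigD1 (Ordinal jd)) //= eqxx big1 // => i.
  by rewrite -val_eqE /= => /negPf ->.
split=> // r rS i; rewrite {1}/q => lt_i l le_il.
have [lt_i'|le_pr] := ltnP (r i) (p i).
  exact: leq_trans (pP r rS i lt_i' l le_il) (le_pq l).
have iE : i = j by move: lt_i; case: eqP => //; lia.
subst i; apply: leq_trans (le_pq l).
have r_j : r j <= p j by move: lt_i; rewrite eqxx; lia.
elim: l le_il => [|l IHl]; first by rewrite leqn0 => /eqP <-.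
rewrite leq_eqVlt => /predU1P [<-//|]; rewrite ltnS => le_jl.
rewrite leqNgt; apply/negP => lt_pr.
have: ok l.+1.
  rewrite /ok (leq_trans lt_pr (rS.1 _)) /=.
  apply: leq_trans (IHl le_jl); apply: leq_trans (rS.2 l).
  by apply: g_mono lt_pr _; apply: stable_cap.
by move/max_j; lia.
Qed.

Lemma segment_exists d h : h <= total d (cap d) ->
  exists2 p, segment d p & total d p = h.
Proof.
elim: h => [|h IHh] h_le.
  by exists (fun=> 0); [exact: segment0 | rewrite /total big1].
have [p pP pE] := IHh (ltnW h_le).
by rewrite -pE in h_le *; have [q qP qE] := segment_succ pP h_le; exists q.
Qed.

Lemma total_shift d p : stable d p -> total d.+1 (shift d p) =
  g d (p 0) + \sum_(j < d.+1 | below t j.+1) p j.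
Proof.
by move=> pS; rewrite /total big_ord_recl; congr (_ + _); rewrite -big_mkcond.
Qed.

(** A segment has the smallest possible p 0, and the largest possible entry at
    t - 1, the only one lost by the shift. *)
Lemma segment_min_growth d p v : segment d p -> stable d v ->
  total d p = total d v -> total d.+1 (shift d p) <= total d.+1 (shift d v).
Proof.
move=> [pS pP] vS eq_pv; rewrite !total_shift //.
apply: leq_add.
  apply: g_mono; last by have := stable_cap 0 vS; rewrite subn0.
  rewrite leqNgt; apply/negP => lt_vp.
  have le_vp j : v j <= p j by apply: pP lt_vp _ _.
  have := total_strict le_vp (leq0n d) lt_vp; lia.
have split_total q : total d q = \sum_(j < d.+1 | below t j.+1) q j
    + \sum_(j < d.+1 | ~~ below t j.+1) q j.
  by rewrite /total (bigID (fun j : 'I_d.+1 => below t j.+1)).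
have : \sum_(j < d.+1 | ~~ below t j.+1) v j <=
       \sum_(j < d.+1 | ~~ below t j.+1) p j.
  apply: leq_sum => j t_j; rewrite leqNgt; apply/negP => lt_pv.
  have le_pv i : p i <= v i.
    rewrite leqNgt; apply/negP => lt_vp; case: (leqP i j) => [le_ij|lt_ji].
      by have := pP v vS i lt_vp j le_ij; lia.
    move: lt_vp; rewrite (stable_out pS) //.
    apply: contraNN t_j => /andP[_]; exact: below_leq.
  by have := total_strict le_pv (leq_ord j) lt_pv; lia.
by move: eq_pv; rewrite !split_total; lia.
Qed.

(** A stable q of degree d+1 without its entry 0 is stable of degree d. If
    q 0 < g d (p 0) then q 1 < p 0 by monotonicity of g, so index 0 reduces to
    index 1. *)
Lemma shift_segment d p : segment d p -> segment d.+1 (shift d p).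
Proof.
move=> [pS pP]; split.
  split=> [[|j]|[|j]] /=.
  - rewrite /cap /= subn0; case: (boolP (below t 0)) => t0.
      by apply: g_le; have := stable_cap 0 pS; rewrite subn0.
    by rewrite (stable_out pS) ?g0 // negb_and t0 orbT.
  - have := pS.1 j; rewrite /cap subSS ltnS.
    case: (boolP (below t j.+1)) => //= tj.
    by rewrite (below_leq _ tj).
  - by rewrite subSS subn0; case: ifP => // _; rewrite g0.
  - rewrite subSS; case: ifP => tj; last by rewrite g0.
    by rewrite (below_leq _ tj) // pS.2.
move=> q qS; pose q' j := q j.+1.
have q'S : stable d q'.
  split=> j; last by rewrite /q' -subSS; apply: qS.2.
  have := qS.1 j.+1; rewrite /q' /cap subSS ltnS.
  case: (boolP (below t j.+1)) => [tj|_]; first by rewrite (below_leq _ tj).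
  by rewrite andbF leqn0 => /eqP ->.
have key i : q i.+1 < p i -> forall j, i <= j -> q j.+1 <= shift d p j.+1.
  move=> lt_i j le_ij /=; case: ifP => tj; first exact: (pP q' q'S i).
  by rewrite (stable_out qS) // tj andbF.
move=> [|i] /= lt_i [|j] le_ij; try by [].
- exact: ltnW.
- have [lt_q1|le_q1] := ltnP (q 1) (p 0); first exact: (key 0).
  have := qS.2 0; rewrite subSS subn0 => q1.
  have := stable_cap 1 qS; rewrite subSS subn0 => /(g_mono le_q1).
  lia.
- by move: lt_i; case: ifP => // ti lt_i; apply: (key i).
Qed.

End StableVectors.

(** * Two variables: sets of largest exponents *)

Section TwoVariables.
Variable t : option nat.

(** The exponents a for which x^a z^(e-a) is nonzero when x^s and z^t vanish. *)
Definition fib s e a := [&& a <= e, a < s & below t (e - a)].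

(** The c largest elements of the fibre. *)
Definition top s e c a := fib s e a && (minn e.+1 s <= a + c).

Lemma sum_interval N l r : \sum_(i < N) (l <= i < r : nat) = minn N r - l.
Proof. elim: N => [|N IHN]; first by rewrite big_ord0; lia.
by rewrite big_ord_recr /= IHN; lia.
Qed.

Definition flo e := if t is Some T then e.+1 - T else 0.

Lemma fibE s e a : fib s e a = (flo e <= a < minn e.+1 s).
Proof. by rewrite /fib /flo; case: t => [T|] /=; lia. Qed.

Lemma topE s e c a :
  top s e c a = (maxn (flo e) (minn e.+1 s - c) <= a < minn e.+1 s).
Proof. by rewrite /top fibE; lia. Qed.

Lemma top_fib s e c a : top s e c a -> fib s e a.
Proof. by case/andP. Qed.

Lemma sum_top s e (X : nat -> bool) : (forall a, X a -> fib s e a) ->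
  \sum_(a < e.+1) (top s e (\sum_(i < e.+1) X i) a : nat) = \sum_(a < e.+1) X a.
Proof.
move=> X_fib; under eq_bigr do rewrite topE.
have : \sum_(a < e.+1) X a <= \sum_(a < e.+1) (flo e <= a < minn e.+1 s : nat).
  by apply: leq_sum => a _; rewrite -fibE; case: (boolP (X a)) => // /X_fib ->.
by rewrite !sum_interval; lia.
Qed.

(** Every element of X outside the top set is smaller, hence has a larger
    z-exponent e - a, than all elements of the top set. *)
Lemma top_weight s e (X : nat -> bool) (Y := top s e (\sum_(i < e.+1) X i)) :
  (forall a, X a -> fib s e a) ->
  \sum_(a < e.+1) Y a * (e - a) + \sum_(a < e.+1) (X a && ~~ Y a) <=
  \sum_(a < e.+1) X a * (e - a).
Proof.
move=> X_fib; have := sum_top X_fib; rewrite -/Y => eqXY.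
(* r is the least element of the top set, up to truncation at the lower end. *)
pose r := minn e.+1 s - \sum_(i < e.+1) X i.
suff: \sum_(a < e.+1) (Y a * (e - a) + (X a && ~~ Y a) + X a * (e - r)) <=
      \sum_(a < e.+1) (X a * (e - a) + Y a * (e - r)).
  rewrite !big_split /= -[\sum_(a < e.+1) X a * (e - r)]big_distrl /=.
  by rewrite -[\sum_(a < e.+1) Y a * (e - r)]big_distrl /= eqXY leq_add2r.
apply: leq_sum => -[a /= a_e] _.
have c_gt0 : X a -> 0 < \sum_(i < e.+1) X i.
  by move=> Xa; rewrite (bigD1 (Ordinal a_e)) //= Xa.
have := X_fib a; rewrite fibE /Y topE -/r; move: @r c_gt0 => /=.
move: (\sum_(i < _) _) => c.
by case: (X a) => /= [/(_ isT) ? /(_ isT)|_ _];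
  case: (boolP (_ <= a < _)) => /=; lia.
Qed.

Lemma sum_gain N (X Y : nat -> bool) b : b < N -> ~~ X b -> Y b ->
  (forall a, X a -> Y a) -> \sum_(a < N) X a < \sum_(a < N) Y a.
Proof.
move=> bN Xb Yb XY; rewrite (bigD1 (Ordinal bN)) //= [ltnRHS](bigD1 (Ordinal bN)) //=.
rewrite (negPf Xb) Yb add0n add1n ltnS; apply: leq_sum => a _.
by case: (boolP (X a)) => // /XY ->.
Qed.

Lemma sum_exchange N (X Y : nat -> bool) l b :
  l < N -> b < N -> ~~ X b -> Y b ->
  (forall a, a != l -> X a -> Y a) -> \sum_(a < N) X a <= \sum_(a < N) Y a.
Proof.
move=> lN bN Xb Yb XY.
have : \sum_(a < N) (X a && (a != l :> nat)) < \sum_(a < N) Y a.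
  apply: (@sum_gain N (fun a => X a && (a != l)) _ b) => //.
    by rewrite (negPf Xb).
  by move=> a /andP[Xa al]; apply: XY.
rewrite [\sum_(a < N) X a](bigD1 (Ordinal lN)) //=.
rewrite [X in X < _](bigD1 (Ordinal lN)) //= eqxx andbF add0n.
rewrite (eq_bigr (fun a : 'I_N => X a : nat)) => [|a /negPf al].
  by case: (X l) => /=; lia.
by rewrite -val_eqE /= in al; rewrite al andbT.
Qed.

Lemma sum_widen N (X : nat -> bool) : ~~ X N ->
  \sum_(a < N.+1) X a = \sum_(a < N) X a.
Proof. by move=> /negPf XN; rewrite big_ord_recr /= XN addn0. Qed.

(** The set X consists of x-exponents in degree e, and Y of those in degree
    e+1 containing the multiples of X by z and by x. When s <= t, going from e to
    e+1 raises the lower end of the fibre only if its upper end stays. So a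
    top set gains one element when the upper end moves, and otherwise loses at
    most its smallest element, and that only when it is the whole fibre. In each
    case Y is shown to be large enough, by exhibiting an element of Y that comes
    from x times an element of X next to a gap of X. *)
Lemma top_grow s e (X Y : nat -> bool) :
  (forall a, a < s -> below t a) ->
  (forall a, X a -> fib s e a) ->
  (forall a, X a -> fib s e.+1 a -> Y a) ->
  (forall a, X a -> fib s e.+1 a.+1 -> Y a.+1) ->
  forall a, top s e (\sum_(i < e.+1) X i) a ->
  (fib s e.+1 a -> top s e.+1 (\sum_(i < e.+2) Y i) a) /\
  (fib s e.+1 a.+1 -> top s e.+1 (\sum_(i < e.+2) Y i) a.+1).
Proof.
move=> s_t X_fib XY XYS.
have XN : ~~ X e.+1 by apply/negP => /X_fib; rewrite /fib; lia.
rewrite -(sum_widen XN); set c := \sum_(i < e.+2) X i.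
set c' := \sum_(i < e.+2) Y i.
have fibP b : fib s e b -> flo e <= b < minn e.+1 s by rewrite fibE.
have flo_s : flo e.+1 <= e.+2 - s \/ s = 0.
  have := s_t s.-1; rewrite /flo; case: (t) => [T|] /=; lia.
have floS : flo e <= flo e.+1 <= (flo e).+1.
  by rewrite /flo; case: (t) => [T|]; lia.
(* If the upper end moves, the successor of the largest element of X is new. *)
have [s_big|s_small] := ltnP e.+1 s.
  have c'P : 0 < c -> c < c'.
    move=> c_gt0.
    have exb : exists b, X b.
      apply: contrapT => nex; move: c_gt0; rewrite /c big1 // => i _.
      by case: (boolP (X i)) => // Xi; case: nex; exists i.
    have b_e b : X b -> b <= e by move=> /X_fib; rewrite /fib => /andP[].
    case: (ex_maxnP exb b_e) => b Xb max_b.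
    apply: (@sum_gain _ _ _ b.+1); first by have := b_e b Xb; lia.
    - by apply/negP => /max_b; rewrite ltnn.
    - by apply: XYS => //; rewrite fibE; have := fibP b (X_fib b Xb); lia.
    - by move=> a Xa; apply: XY => //; rewrite fibE; have := fibP a (X_fib a Xa); lia.
  by move=> a; rewrite !fibE !topE; lia.
(* If both ends stay, or X misses the lower end, Y contains X. *)
have [lt_flo|le_flo] := ltnP (flo e) (flo e.+1); last first.
  have cc' : c <= c'.
    apply: leq_sum => i _; case: (boolP (X i)) => // Xi; rewrite XY //.
    by rewrite fibE; have := fibP i (X_fib i Xi); lia.
  by move=> a; rewrite !fibE !topE; lia.
have [Xl|Xl] := boolP (X (flo e)); last first.
  have cc' : c <= c'.
    apply: leq_sum => i _; case: (boolP (X i)) => // Xi; rewrite XY //.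
    have : i != flo e :> nat by apply: contraNneq Xl => <-.
    by rewrite fibE; have := fibP i (X_fib i Xi); lia.
  by move=> a; rewrite !fibE !topE; lia.
(* From here on X contains the lower end, which is lost. If X has a gap,
   the first gap is filled by x times its predecessor. *)
have [full|] := pselect (forall b, fib s e b -> X b).
  have c_le : c <= minn e.+2 (minn e.+1 s) - flo e.
    rewrite -sum_interval; apply: leq_sum => i _.
    by case: (boolP (X i)) => // /X_fib; rewrite fibE => ->.
  have c'_ge : minn e.+2 (minn e.+1 s) - (flo e).+1 <= c'.
    rewrite -sum_interval; apply: leq_sum => i _.
    case: (boolP (flo e < i < _)) => // i_in; rewrite XY ?fibE //; last by lia.
    by apply: full; rewrite fibE; lia.
  by move=> a; rewrite !fibE !topE; lia.
move=> /existsNP[b0 /not_implyP [b0_fib /negP Xb0]].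
have exb : exists b, fib s e b && ~~ X b by exists b0; rewrite b0_fib.
case: (ex_minnP exb) => b /andP[b_fib Xb] min_b.
have b_l : b != flo e by apply: contraNneq Xb => ->.
have bP := fibP b b_fib.
have Xb1 : X b.-1.
  apply: contrapT => /negP Xb1; have : b <= b.-1.
    by apply: min_b; rewrite Xb1 fibE; lia.
  by lia.
have cc' : c <= c'.
  apply: (@sum_exchange _ _ _ (flo e) b) => //; try lia.
    have -> : b = b.-1.+1 by lia.
    by apply: XYS => //; rewrite fibE; lia.
  move=> a al Xa; apply: XY => //; rewrite fibE.
  by have := fibP a (X_fib a Xa); lia.
by move=> a; rewrite !fibE !topE; lia.
Qed.

(** Multiplying by a further variable can only lower the bound s to s'. A top
    set loses as many elements as possible to that. *)
Lemma top_restrict s s' e (X Y : nat -> bool) : s' <= s ->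
  (forall a, X a -> fib s e a) ->
  (forall a, X a -> fib s' e a -> Y a) ->
  forall a, top s e (\sum_(i < e.+1) X i) a -> fib s' e a ->
  top s' e (\sum_(i < e.+1) Y i) a.
Proof.
move=> le_s X_fib XY a; rewrite !topE fibE.
have : \sum_(i < e.+1) X i <=
    \sum_(i < e.+1) Y i + \sum_(i < e.+1) (s' <= i < s : nat).
  rewrite -big_split /=; apply: leq_sum => i _.
  case: (boolP (X i)) => // Xi; have := XY i Xi; have := X_fib i Xi.
  rewrite !fibE; case: (Y i) => //= H /implyP; lia.
by rewrite sum_interval; lia.
Qed.

End TwoVariables.

(** * Compression of sets of monomials *)

Section Monomials.
Variable n : nat.
Implicit Types u v w : 'X_{1..n}.

Definition monosle d : seq 'X_{1..n} := map (@bmnm n d.+1) (enum {: 'X_{1..n < d.+1}}).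
Definition monos d : seq 'X_{1..n} := [seq u <- monosle d | mdeg u == d].

Lemma mem_monosle d u : (u \in monosle d) = (mdeg u <= d).
Proof.
apply/mapP/idP => [[v _ ->]|]; first by rewrite -ltnS bmdeg.
by rewrite -ltnS => u_d; exists (BMultinom u_d); rewrite ?mem_enum.
Qed.

Lemma monosle_uniq d : uniq (monosle d).
Proof. by rewrite map_inj_uniq ?enum_uniq //; apply: val_inj. Qed.

Lemma mem_monos d u : (u \in monos d) = (mdeg u == d).
Proof. by rewrite mem_filter mem_monosle; case: eqP => // ->; rewrite leqnn. Qed.

Lemma monos_uniq d : uniq (monos d).
Proof. by rewrite filter_uniq ?monosle_uniq. Qed.

Lemma sum_monosle d (F : 'X_{1..n} -> nat) :
  \sum_(u <- monosle d) F u = \sum_(j < d.+1) \sum_(u <- monos (d - j)) F u.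
Proof.
rewrite big_seq (partition_big (fun u => inord (d - mdeg u) : 'I_d.+1) predT) //=.
apply: eq_bigr => j _.
rewrite -big_seq_cond -big_filter; apply: perm_big; apply: uniq_perm.
- by rewrite filter_uniq ?monosle_uniq.
- exact: monos_uniq.
move=> u; rewrite mem_filter mem_monosle mem_monos -val_eqE /=.
by have := ltn_ord j; case: leqP => u_d; rewrite ?inordK; lia.
Qed.

Definition put (i : 'I_n) u (a : nat) : 'X_{1..n} :=
  [multinom if j == i then a else u j | j < n].

Lemma putE i u a j : put i u a j = if j == i then a else u j.
Proof. by rewrite mnmE. Qed.

Lemma put_at i u a : put i u a i = a.
Proof. by rewrite putE eqxx. Qed.

Lemma put_put i u a b : put i (put i u a) b = put i u b.
Proof. by apply/mnmP => j; rewrite !putE; case: eqP. Qed.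

Lemma put_id i u : put i u (u i) = u.
Proof. by apply/mnmP => j; rewrite putE; case: eqP => // ->. Qed.

Lemma put_addi i u a : put i (u + U_(i)) a = put i u a.
Proof.
apply/mnmP => j; rewrite !putE mnmDE mnm1E eq_sym.
by case: eqP => // _; rewrite addn0.
Qed.

Lemma put_addk i k u a : k != i -> put i (u + U_(k)) a = (put i u a + U_(k))%MM.
Proof.
move=> ki; apply/mnmP => j; rewrite mnmDE !putE mnmDE mnm1E.
by case: eqP => // ->; rewrite (negPf ki) addn0.
Qed.

Lemma mdeg_put i u a : mdeg (put i u a) + u i = mdeg u + a.
Proof.
rewrite !mdegE (bigD1 i) //= [in RHS](bigD1 i) //= put_at.
rewrite (eq_bigr (fun j => u j)) => [|j /negPf ji]; last by rewrite putE ji.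
by lia.
Qed.

Lemma mdeg_ge u i : u i <= mdeg u.
Proof. by rewrite mdegE (bigD1 i) //= leq_addr. Qed.

Lemma sum_fibres i d (F : 'X_{1..n} -> nat) : \sum_(u <- monosle d) F u =
  \sum_(w <- monosle d | w i == 0) \sum_(a < (d - mdeg w).+1) F (put i w a).
Proof.
under [RHS]eq_bigr => w _ do rewrite -(big_mkord xpredT (fun a => F (put i w a))).
rewrite -[RHS]big_filter.
transitivity (\sum_(u <- [seq put i w a
                         | w <- [seq w : 'X_{1..n} <- monosle d | w i == 0],
                           a <- iota 0 (d - mdeg w).+1]) F u); last first.
  by rewrite big_allpairs_dep; apply: eq_bigr => w _; rewrite /index_iota subn0.
apply: perm_big; apply: uniq_perm; first exact: monosle_uniq.
  apply: allpairs_uniq_dep; first by rewrite filter_uniq ?monosle_uniq.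
    by move=> w _; apply: iota_uniq.
  move=> _ _ /allpairsPdep[w [a [+ _ ->]]] /allpairsPdep[w' [a' [+ _ ->]]] /=.
  rewrite !mem_filter => /andP[/eqP w0 _] /andP[/eqP w0' _] eq_put.
  have eq_w : w = w'.
    have := congr1 (fun u => put i u 0) eq_put; rewrite !put_put.
    by rewrite -{1}w0 -{1}w0' !put_id.
  by subst w'; have := congr1 (fun u : 'X_{1..n} => u i) eq_put; rewrite !put_at => ->.
move=> u; rewrite mem_monosle; apply/idP/allpairsPdep => [u_d|].
  have := mdeg_put i u 0; rewrite addn0 => put0.
  exists (put i u 0), (u i); rewrite put_put put_id mem_filter mem_monosle put_at.
  by rewrite mem_iota eqxx; split=> //; lia.
move=> [w [a [+ + ->]]]; rewrite mem_filter mem_monosle mem_iota.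
by move=> /andP[/eqP w0 w_d] a_d; have := mdeg_put i w a; lia.
Qed.

Section Compression.
Variables (t : option nat) (nz : pred 'X_{1..n}).
Hypothesis nz_down : forall u v, (u <= v)%MM -> nz v -> nz u.
Hypothesis nz_below : forall u i, nz u -> below t (u i).

(** u codes the monomial u z^(d - mdeg u) of degree d; the last condition says
    that z^t does not divide it. *)
Definition std d u := [&& mdeg u <= d, nz u & below t (d - mdeg u)].

(** M' contains the nonzero multiples of M by z (same code u) and by x_k (code
    u + U_(k)). *)
Definition shadow d (M M' : pred 'X_{1..n}) := forall u, M u ->
  (std d.+1 u -> M' u) /\ forall k, std d.+1 (u + U_(k))%MM -> M' (u + U_(k))%MM.

Variable N : nat.

(** The exponent from which powers of x_i kill the monomial u without its
    x_i-part, cut off at N: with t infinite there may be no such exponent,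
    and N exceeds all degrees considered. *)
Definition ceil i u := \sum_(a < N) nz (put i u a).

(** The joint degree in x_i and z of the monomial of degree d coded by u. *)
Definition height d i u := d - (mdeg u - u i).

Definition compress d i (M : pred 'X_{1..n}) : pred 'X_{1..n} := fun u =>
  (mdeg u <= d) &&
  top t (ceil i u) (height d i u)
    (\sum_(a < (height d i u).+1) M (put i u a)) (u i).

Lemma sum_down K (Q : nat -> bool) : (forall a b, a <= b -> Q b -> Q a) ->
  forall a, a < K -> Q a = (a < \sum_(b < K) Q b).
Proof.
move=> Qdown; elim: K => // K IHK a; rewrite ltnS big_ord_recr /= => a_K.
have sumK : \sum_(b < K) Q b <= K.
  rewrite -[leqRHS]card_ord -sum1_card; apply: leq_sum => b _; exact: leq_b1.
have [QK|QK] := boolP (Q K).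
  rewrite (Qdown _ _ a_K QK); have : \sum_(b < K) Q b = K.
    rewrite -[RHS]card_ord -sum1_card; apply: eq_bigr => b _.
    by rewrite (Qdown _ _ (ltnW (ltn_ord b)) QK).
  by move=> ->; lia.
rewrite addn0; move: a_K; rewrite leq_eqVlt => /predU1P[->|]; last exact: IHK.
by rewrite (negPf QK) ltnNge sumK.
Qed.

Lemma put_le i u a b : a <= b -> (put i u a <= put i u b)%MM.
Proof. by move=> ab; apply/mnm_lepP => j; rewrite !putE; case: eqP. Qed.

Lemma ceilP i u a : a < N -> nz (put i u a) = (a < ceil i u).
Proof.
apply: (@sum_down N (fun a => nz (put i u a))) => b c bc.
by apply: nz_down; apply: put_le.
Qed.

Lemma ceil_le i u v : (u <= v)%MM -> ceil i v <= ceil i u.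
Proof.
move=> uv; apply: leq_sum => a _; case: (boolP (nz (put i v a))) => // nzv.
rewrite (nz_down _ nzv) //; apply/mnm_lepP => j; rewrite !putE.
by case: eqP => // _; apply/mnm_lepP.
Qed.

Lemma ceil_below i u a : a < ceil i u -> below t a.
Proof.
move=> a_c; have aN : a < N.
  apply: leq_trans a_c _; rewrite -[leqRHS]card_ord -sum1_card.
  by apply: leq_sum => b _; apply: leq_b1.
by move: a_c; rewrite -ceilP // => /(nz_below i); rewrite put_at.
Qed.

Lemma ceil_put i u a : ceil i (put i u a) = ceil i u.
Proof. by apply: eq_bigr => b _; rewrite put_put. Qed.

Lemma height_put d i u a : height d i (put i u a) = height d i u.
Proof. by rewrite /height put_at; have := mdeg_put i u a; lia. Qed.

Lemma std_fib d i u a : d < N -> mdeg u - u i <= d ->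
  std d (put i u a) = fib t (ceil i u) (height d i u) a.
Proof.
move=> dN ud; rewrite /std /fib /height.
have := mdeg_put i u a; have := mdeg_ge u i => ui putE.
have -> : (mdeg (put i u a) <= d) = (a <= d - (mdeg u - u i)) by lia.
have [a_e|//] := leqP a; rewrite ceilP; last by lia.
by congr [&& _, _ & below t _]; lia.
Qed.

Section Degree.
Variables (d : nat) (i : 'I_n) (M : pred 'X_{1..n}).
Lemma compress_put u a : mdeg u - u i <= d -> a <= height d i u ->
  compress d i M (put i u a) =
  top t (ceil i u) (height d i u) (\sum_(b < (height d i u).+1) M (put i u b)) a.
Proof.
rewrite /compress ceil_put height_put put_at /height => ud a_h.
have := mdeg_put i u a; have := mdeg_ge u i => ui putE.
have -> : (mdeg (put i u a) <= d) by lia.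
by congr top; apply: eq_bigr => b _; rewrite put_put.
Qed.

Hypothesis dN : d < N.
Hypothesis M_std : forall u, M u -> std d u.

Lemma M_fib u a : mdeg u - u i <= d -> M (put i u a) ->
  fib t (ceil i u) (height d i u) a.
Proof. by move=> ud /M_std; rewrite std_fib. Qed.

Lemma compress_std u : compress d i M u -> std d u.
Proof.
case/andP => u_d /top_fib; have ud : mdeg u - u i <= d by lia.
by rewrite -std_fib // put_id.
Qed.

Lemma height0 w : w i = 0 -> height d i w = d - mdeg w.
Proof. by rewrite /height => ->; rewrite subn0. Qed.

Lemma card_compress :
  \sum_(u <- monosle d) compress d i M u = \sum_(u <- monosle d) M u.
Proof.
rewrite !(sum_fibres i) big_seq_cond [RHS]big_seq_cond.
apply: eq_bigr => w /andP[]; rewrite mem_monosle => w_d /eqP w0.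
have wd : mdeg w - w i <= d by lia.
have hE := height0 w0; rewrite -hE.
rewrite -(@sum_top t (ceil i w) (height d i w) (fun a => M (put i w a))).
  by apply: eq_bigr => a _; rewrite compress_put ?leq_ord.
by move=> a; apply: M_fib.
Qed.

(** The weight counts the total z-exponent; it drops strictly unless M is
    contained in its compression, which makes the iteration of compressions end. *)
Lemma compress_weight :
  \sum_(u <- monosle d) compress d i M u * (d - mdeg u) +
  \sum_(u <- monosle d) (M u && ~~ compress d i M u) <=
  \sum_(u <- monosle d) M u * (d - mdeg u).
Proof.
rewrite !(sum_fibres i) -big_split /= big_seq_cond [leqRHS]big_seq_cond.
apply: leq_sum => w /andP[]; rewrite mem_monosle => w_d /eqP w0.
have wd : mdeg w - w i <= d by lia.
have hE := height0 w0; rewrite -hE.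
have dE a : d - mdeg (put i w a) = height d i w - a.
  by rewrite hE; have := mdeg_put i w a; lia.
under eq_bigr => a _ do rewrite dE compress_put ?leq_ord //.
under [X in _ + X]eq_bigr => a _ do rewrite compress_put ?leq_ord //.
under [leqRHS]eq_bigr => a _ do rewrite dE.
apply: (@top_weight t (ceil i w) _ (fun a => M (put i w a))) => a.
exact: M_fib.
Qed.

Lemma compress_stable u : compress d i M u -> mdeg u < d ->
  nz (u + U_(i))%MM -> compress d i M (u + U_(i))%MM.
Proof.
move=> Cu u_d nzu; have ud : mdeg u - u i <= d by lia.
have ui := mdeg_ge u i.
have uE : (u + U_(i))%MM = put i u (u i).+1.
  by rewrite -(put_addi i u) -[LHS](put_id i) mnmDE mnm1E eqxx addn1.
have h_u : u i < height d i u by rewrite /height; lia.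
rewrite -(put_id i u) compress_put ?(ltnW h_u) // in Cu.
rewrite uE compress_put //; move: Cu => /andP[Fu top_u].
rewrite /top; apply/andP; split; last by lia.
have u_c : (u i).+1 < ceil i u.
  by rewrite -ceilP -?uE //; rewrite /height in h_u; lia.
move: Fu; rewrite /fib h_u u_c /= => /and3P[_ _].
by apply: below_leq; lia.
Qed.

End Degree.

(** Multiplication by z and by x_i moves a fibre to the one of next higher
    degree; multiplication by another variable keeps the degree of the fibre and
    lowers its ceiling. *)
Lemma compress_shadow d i (M M' : pred 'X_{1..n}) : d.+1 < N ->
  (forall u, M u -> std d u) -> shadow d M M' ->
  shadow d (compress d i M) (compress d.+1 i M').
Proof.
move=> dN M_std sh u Cu; have u_d : mdeg u <= d by case/andP: Cu.
have ui := mdeg_ge u i.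
have ud : mdeg u - u i <= d by lia.
have ud' : mdeg u - u i <= d.+1 by lia.
have hS : height d.+1 i u = (height d i u).+1 by rewrite /height; lia.
have h_u : u i <= height d i u by rewrite /height; lia.
move: (Cu); rewrite -{1}(put_id i u) compress_put // => top_u.
have uE : (u + U_(i))%MM = put i u (u i).+1.
  by rewrite -(put_addi i u) -[LHS](put_id i) mnmDE mnm1E eqxx addn1.
have putS a : put i u a.+1 = (put i u a + U_(i))%MM.
  by rewrite -(put_id i (_ + _)%MM) mnmDE put_at mnm1E eqxx addn1 put_addi put_put.
have X_fib a : M (put i u a) -> fib t (ceil i u) (height d i u) a.
  exact: M_fib (ltnW dN) M_std _ _ ud.
have XY a : M (put i u a) -> fib t (ceil i u) (height d i u).+1 a ->
    M' (put i u a).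
  by rewrite -hS -std_fib // => /sh[+ _]; apply.
have XYS a : M (put i u a) -> fib t (ceil i u) (height d i u).+1 a.+1 ->
    M' (put i u a.+1).
  by rewrite -hS -std_fib // putS => /sh[_]; apply.
have [growz growx] := top_grow (@ceil_below i u) X_fib XY XYS top_u.
split=> [u_std|k uk_std].
  rewrite -(put_id i u) compress_put ?hS ?(leq_trans h_u) //.
  by apply: growz; rewrite -hS -std_fib // put_id.
have [ki|ki] := eqVneq k i.
  subst k; rewrite uE compress_put ?hS //.
  by apply: growx; rewrite -hS -std_fib // -uE.
have le_u : (u <= u + U_(k))%MM by apply: lem_addr.
have ukE : (u + U_(k))%MM = put i (u + U_(k)) (u i).
  by rewrite put_addk // put_id.
have uki : (u + U_(k))%MM i = u i by rewrite mnmDE mnm1E (negPf ki) addn0.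
have hE : height d.+1 i (u + U_(k)) = height d i u.
  by rewrite /height mdegD mdeg1 uki; lia.
have udk : mdeg (u + U_(k)) - (u + U_(k))%MM i <= d.+1.
  by rewrite mdegD mdeg1 uki; lia.
rewrite ukE compress_put ?hE //.
apply: (@top_restrict t (ceil i u) _ _ (fun a => M (put i u a))
  (fun b => M' (put i (u + U_(k)) b)) _ _ _ _ top_u).
- exact: ceil_le.
- by move=> a; apply: M_fib => //; apply: ltnW.
- move=> a Ma; rewrite -hE -std_fib // put_addk //.
  exact: (sh _ Ma).2.
- by rewrite -hE -std_fib // -ukE.
Qed.

(** In terms of monomials: replacing a factor z by x_i stays in M, unless the
    result is zero. *)
Definition xstable d (M : pred 'X_{1..n}) :=
  forall u i, M u -> mdeg u < d -> nz (u + U_(i))%MM -> M (u + U_(i))%MM.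

Lemma exists_xstable d (M M' : pred 'X_{1..n}) : d.+1 < N ->
  (forall u, M u -> std d u) -> (forall u, M' u -> std d.+1 u) ->
  shadow d M M' ->
  exists M1 M1' : pred 'X_{1..n},
    [/\ forall u, M1 u -> std d u, forall u, M1' u -> std d.+1 u,
        shadow d M1 M1', xstable d M1
      & \sum_(u <- monosle d) M1 u = \sum_(u <- monosle d) M u /\
        \sum_(u <- monosle d.+1) M1' u = \sum_(u <- monosle d.+1) M' u].
Proof.
move=> dN.
have [K] := ubnP (\sum_(u <- monosle d) M u * (d - mdeg u)).
elim: K M M' => // K IHK M M' ltK M_std M'_std sh.
have [M_xs|nst] := pselect (xstable d M); first by exists M, M'.
have [i Mi] : exists i, 0 < \sum_(u <- monosle d) (M u && ~~ compress d i M u).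
  apply: contrapT => /forallNP all0; apply: nst => u i Mu u_d nzu.
  have sub v : M v -> compress d i M v.
    move=> Mv; apply: contrapT => /negP Cv; apply: (all0 i).
    rewrite (perm_big _ (perm_to_rem (_ : v \in _))) ?big_cons /= ?Mv ?Cv //.
    by rewrite mem_monosle; case/and3P: (M_std v Mv).
  have Cu := compress_stable (ltnW dN) (sub u Mu) u_d nzu.
  apply: contrapT => /negP nMu.
  have := card_compress i (ltnW dN) M_std; apply/eqP.
  rewrite neq_ltn; apply/orP; right.
  have u_in : (u + U_(i))%MM \in monosle d.
    by rewrite mem_monosle mdegD mdeg1 addn1.
  rewrite !(perm_big _ (perm_to_rem u_in)) !big_cons /= (negPf nMu) Cu add0n.
  rewrite ltnS; apply: leq_sum => v _.
  by case: (boolP (M v)) => // /sub ->.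
have := compress_weight i (ltnW dN) M_std => wt.
have [||||M1 [M1' [M1s M1s' sh1 xs1 [eq1 eq1']]]] :=
  IHK (compress d i M) (compress d.+1 i M').
- by lia.
- exact: compress_std (ltnW dN).
- exact: compress_std.
- exact: compress_shadow.
exists M1, M1'; split=> //; rewrite eq1 eq1' !card_compress //; exact: ltnW.
Qed.

End Compression.
End Monomials.

(** * Dimensions from leading monomials *)

Import Order.TTheory GRing.Theory.
Local Open Scope ring_scope.
Local Open Scope classical_set_scope.
Local Open Scope quotient_scope.

Section BasisDimension.
Variables (k : fieldType) (R : comAlgType k).
Implicit Types V : set R.

Lemma basis_size_leq V m m' (e : 'I_m -> R) (e' : 'I_m' -> R) :
  is_basis V e -> is_basis V e' -> (m <= m')%N.
Proof.
move=> [eV e_free _] [_ _ e'_span].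
have /choice [C CP] : forall i, exists c : 'I_m' -> k, e i = \sum_j c j *: e' j.
  by move=> i; apply: e'_span.
pose A := \matrix_(i, j) C i j.
have A_free : row_free A.
  rewrite -kermx_eq0; apply/eqP/row_matrixP => r.
  set u := row r _; have uA : u *m A = 0 by rewrite -row_mul mulmx_ker row0.
  rewrite row0; apply/rowP => i; rewrite [RHS]mxE.
  move: i; apply: (e_free (fun i => u 0 i)); under eq_bigr => i _ do rewrite CP scaler_sumr.
  rewrite exchange_big big1 //= => j _.
  under eq_bigr => i _ do rewrite scalerA.
  rewrite -scaler_suml; have /rowP/(_ j) := uA; rewrite !mxE => uAj.
  rewrite (_ : \sum_i _ = 0) ?scale0r // -[RHS]uAj.
  by apply: eq_bigr => i _; rewrite [A _ _]mxE.
by rewrite -(eqP A_free) rank_leq_col.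
Qed.

Lemma kdim_basis V m (e : 'I_m -> R) : is_basis V e -> kdim V = m.
Proof.
move=> eV; rewrite /kdim; case: xgetP => [m' _ [e' e'V]|/(_ m) []].
  by apply/eqP; rewrite eqn_leq (basis_size_leq eV e'V) (basis_size_leq e'V eV).
by exists e.
Qed.

End BasisDimension.

Section LeadingMonomials.
Variables (k : fieldType) (n : nat).
Local Notation A := {mpoly k[n]}.
Implicit Types (V W : set A) (m : 'X_{1..n}).

Definition lspace V := V 0 /\ forall c f g, V f -> V g -> V (c *: f + g).

Definition lead_of V m := exists f, [/\ V f, f != 0 & mlead f = m].

Lemma lspaceZ V c f : lspace V -> V f -> V (c *: f).
Proof. by move=> [V0 VP] Vf; rewrite -[_ *: _]addr0; apply: VP. Qed.

Lemma lspaceD V f g : lspace V -> V f -> V g -> V (f + g).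
Proof. by move=> [_ VP] Vf Vg; rewrite -[f]scale1r; apply: VP. Qed.

Lemma lspaceB V f g : lspace V -> V f -> V g -> V (f - g).
Proof. by move=> [_ VP] Vf Vg; rewrite addrC -scaleN1r; apply: VP. Qed.

Lemma lspace_sum V (I : Type) (r : seq I) (F : I -> A) : lspace V ->
  (forall i, V (F i)) -> V (\sum_(i <- r) F i).
Proof.
move=> VS VF; elim: r => [|i r IHr]; first by rewrite big_nil; case: VS.
by rewrite big_cons; apply: lspaceD.
Qed.

(** Gaussian elimination: subtracting multiples of elements of V lowers the
    leading monomial of an element of W until it vanishes. *)
Lemma lead_sub V W : lspace V -> lspace W -> V `<=` W ->
  (forall m, lead_of W m -> lead_of V m) -> W `<=` V.
Proof.
move=> VS WS VW lead_WV f; elim/mleadrect: f => f IHf Wf.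
have [->|f0] := eqVneq f 0; first by case: VS.
have [g [Vg g0 gf]] : lead_of V (mlead f) by apply: lead_WV; exists f.
have gc0 : g@_(mlead f) != 0 by rewrite -gf mleadc_eq0.
set c := f@_(mlead f) / g@_(mlead f).
rewrite -[f](subrK (c *: g)); apply: lspaceD => //; last exact: lspaceZ.
set h := f - c *: g; have Wh : W h by apply: lspaceB => //; apply: lspaceZ => //; apply: VW.
have hf0 : h@_(mlead f) = 0 by rewrite mcoeffB mcoeffZ divfK ?subrr.
have [->|h0] := eqVneq h 0; first by case: VS.
apply: IHf => //; rewrite lt_neqAle; apply/andP; split.
  by apply: contraNneq h0 => hf; rewrite -mleadc_eq0 hf hf0.
apply: le_trans (mleadB_le _ _) _; rewrite leUx lexx /= -gf.
exact: mleadZ_le.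
Qed.

Definition piece V d : set A := V `&` [set f : A | f \is d.-homog].

Lemma piece_lspace V d : lspace V -> lspace (piece V d).
Proof.
move=> VS; split=> [|c f g [Vf fd] [Vg gd]].
  by split; [case: VS | apply: dhomog0].
split; first by case: VS => _; apply.
by apply: dhomogD => //; apply: dhomogZ.
Qed.

Lemma lead_of_piece V d m : lead_of (piece V d) m -> mdeg m = d.
Proof.
by case=> f [[_ /dhomogP fd] f0 <-]; apply: fd; apply: mlead_supp.
Qed.

Section Quotient.
Variable a : idealr A.
Local Notation Q := {ideal_quot a}.

Lemma pi_eq (f g : A) : (\pi_Q f = \pi_Q g) <-> (f - g \in a).
Proof. by rewrite Quotient.idealrBE; split=> [->|/eqP]. Qed.

Lemma pi_eq0 (f : A) : (\pi_Q f = 0) <-> (f \in a).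
Proof. by have := pi_eq f 0; rewrite rmorph0 subr0. Qed.

Lemma piZ c (f : A) : c *: (\pi_Q f : Q) = \pi_Q (c *: f).
Proof. exact: pi_scale. Qed.

Hypothesis a_mono : forall f, f \in a -> forall m, m \in msupp f -> 'X_[m] \in a.

(** Elements of V, one for each leading monomial outside a, give a basis of the
    image of V: they are independent since a is a monomial ideal, and they span by
    elimination, the monomials of a being available in V. *)
Lemma kdim_piece V d : lspace V -> (forall f, f \in a -> V f) ->
  kdim [set \pi_Q f | f in piece V d] =
  (\sum_(m <- monos n d) (`[< lead_of (piece V d) m >] && ('X_[m] \notin a)))%N.
Proof.
move=> VS aV; set W := piece V d.
pose P m := `[< lead_of W m >] && ('X_[m] \notin a).
have WS : lspace W by apply: piece_lspace.
pose s := [seq m <- monos n d | P m].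
have -> : (\sum_(m <- monos n d) (`[< lead_of W m >] && ('X_[m] \notin a)))%N = size s.
  by rewrite size_filter -sum1_count [RHS]big_mkcond.
pose lm (i : 'I_(size s)) := nth 0%MM s i.
have lmP i : P (lm i).
  by have := mem_nth 0%MM (ltn_ord i); rewrite mem_filter => /andP[].
have lm_inj : injective lm.
  move=> i j /eqP; rewrite nth_uniq //; last exact/filter_uniq/monos_uniq.
  by move/eqP/val_inj.
have /choice [f fP] : forall i, exists f, [/\ W f, f != 0 & mlead f = lm i].
  by move=> i; case/andP: (lmP i) => /asboolP.
apply: (@kdim_basis _ _ _ _ (fun i => \pi_Q (f i))); split.
- by move=> i; exists (f i) => //; case: (fP i).
- move=> c; under eq_bigr do rewrite piZ.
  rewrite -raddf_sum => /pi_eq0 fa i0; apply/eqP; apply: contrapT => /negP ci0.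
  (* The largest leading monomial occurring cannot cancel. *)
  case: (@Order.TotalTheory.arg_maxP _ _ _ i0 (fun i => c i != 0) lm ci0) => i ci max_i.
  case/andP: (lmP i) => _ /negP; apply; apply: (a_mono fa).
  rewrite mcoeff_msupp raddf_sum (bigD1 i) //= big1 ?addr0.
    have [_ fi0 <-] := fP i.
    by rewrite mcoeffZ mulf_neq0 // mleadc_eq0.
  move=> j ji; rewrite mcoeffZ; have [->|cj] := eqVneq (c j) 0; first by rewrite mul0r.
  rewrite mcoeff_gt_mlead ?mulr0 //; have [_ _ ->] := fP j.
  have le_ji : (lm j <= lm i)%O by apply: max_i.
  rewrite lt_neqAle le_ji andbT.
  by apply: contraNneq ji => /lm_inj ->.
move=> _ [g Wg <-].
(* Elements of W in the span of the f i modulo a. *)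
pose W' : set A := [set g | W g /\ exists c : 'I_(size s) -> k, g - \sum_i c i *: f i \in a].
suff : W `<=` W'.
  move=> /(_ g Wg) [_ [c /pi_eq ->]]; exists c; rewrite raddf_sum /=.
  by apply: eq_bigr => i _; rewrite piZ.
apply: lead_sub => //.
- split=> [|c x y [Wx [cx xP]] [Wy [cy yP]]].
    split; first by case: WS.
    exists (fun=> 0); rewrite big1 ?subr0 ?rpred0 // => i _; exact: scale0r.
  split; first by case: WS => _; apply.
  exists (fun i => c * cx i + cy i).
  rewrite (_ : _ - _ = c%:MP * (x - \sum_i cx i *: f i) + (y - \sum_i cy i *: f i)).
    by rewrite rpredD // idealMr.
  under eq_bigr do rewrite scalerDl -scalerA.
  by rewrite big_split /= -scaler_sumr mulrBr !mul_mpolyC opprD addrACA.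
- by move=> x [].
move=> m Wm; have md := lead_of_piece Wm.
have [ma|ma] := boolP ('X_[m] \in a).
  exists 'X_[m]; split; last exact: mleadXm.
    split; first by split; [apply: aV | rewrite /= dhomogX; apply/eqP].
    exists (fun=> 0); rewrite big1 ?subr0 // => i _; exact: scale0r.
  by rewrite -msupp_eq0 msuppX.
have ms : m \in s by rewrite mem_filter mem_monos md eqxx /P ma; move/asboolP: Wm => ->.
have im : (index m s < size s)%N by rewrite index_mem.
have [Wf f0 lf] := fP (Ordinal im).
exists (f (Ordinal im)); split=> //; last by rewrite lf /lm nth_index.
split=> //; exists (fun j => (j == Ordinal im)%:R).
rewrite (bigD1 (Ordinal im)) //= eqxx scale1r big1 ?addr0 ?subrr ?rpred0 //.
by move=> j /negPf ->; rewrite scale0r.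
Qed.

Definition lift_set (J : set Q) : set A := [set f | J (\pi_Q f)].

Lemma lift_set_lspace J : is_ideal J -> lspace (lift_set J).
Proof.
move=> [J0 JP]; split=> [|c f g Jf Jg]; first by rewrite /lift_set /= rmorph0.
by rewrite /lift_set /= -mul_mpolyC rmorphD rmorphM; apply: JP.
Qed.

Lemma lift_set_ideal J f : is_ideal J -> f \in a -> lift_set J f.
Proof. by move=> [J0 _] /pi_eq0; rewrite /lift_set /= => ->. Qed.

Lemma lift_setM J f g : is_ideal J -> lift_set J f -> lift_set J (g * f).
Proof.
move=> [J0 JP] Jf; rewrite /lift_set /= rmorphM -[_ * _]addr0; exact: JP.
Qed.

(** The leading monomials of the preimage of J in degree d, without those that
    vanish in the quotient. *)
Definition std_leads (J : set Q) d m : bool :=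
  `[< lead_of (piece (lift_set J) d) m >] && ('X_[m] \notin a).

Lemma hilb_leads J d : is_ideal J ->
  hilb (quot_gr a) J d = (\sum_(m <- monos n d) std_leads J d m)%N.
Proof.
move=> JI; rewrite -kdim_piece; first last.
- by move=> f; apply: lift_set_ideal.
- exact: lift_set_lspace.
congr kdim; apply/seteqP; split=> [x [Jx [f fd fx]]|_ [f [Jf fd] <-]].
  by exists f => //; split=> //; rewrite /lift_set /= fx.
by split=> //; exists f.
Qed.

Lemma lead_of_mulX V d m i : (forall f g, V f -> V (g * f)) ->
  lead_of (piece V d) m -> lead_of (piece V d.+1) (m + U_(i)).
Proof.
move=> VM [f [[Vf fd] f0 <-]]; exists ('X_i * f).
have X0 : ('X_i : A) != 0 by rewrite -msupp_eq0 msuppX.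
split; first by split; [apply: VM | apply: (dhomogM (d := 1)); rewrite // dhomogX; apply/eqP/mdeg1].
  by rewrite mulf_neq0.
by rewrite mleadM // mleadXm addmC.
Qed.

Lemma std_leads_mulX J d m i : is_ideal J -> std_leads J d m ->
  'X_[m + U_(i)] \notin a -> std_leads J d.+1 (m + U_(i)).
Proof.
move=> JI /andP[/asboolP Jm _] ma; rewrite /std_leads ma andbT; apply/asboolP.
by apply: lead_of_mulX Jm => f g; apply: lift_setM.
Qed.

Section HomogeneousIdeal.
Variable V : set A.
Hypothesis VS : lspace V.
Hypothesis V_X : forall f i, V f -> V ('X_i * f).
Hypothesis V_homog : forall f d, V f -> V (pihomog mdeg d f).
Hypothesis V_a : forall f, f \in a -> V f.

Lemma mulX_closed_mul f g : V f -> V (g * f).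
Proof.
move=> Vf; rewrite [g]mpolyE mulr_suml; apply: lspace_sum => // m.
rewrite -scalerAl; apply: lspaceZ => //.
rewrite mpolyXE_id; elim: (index_enum _) => [|i r IHr].
  by rewrite big_nil mul1r.
rewrite big_cons -mulrA; elim: (m i) => [|e IHe]; first by rewrite mul1r.
by rewrite exprS -mulrA; apply: V_X.
Qed.

Lemma lift_image f : lift_set [set \pi_Q g | g in V] f <-> V f.
Proof.
split=> [[g Vg /pi_eq gf]|Vf]; last by exists f.
by rewrite -[f](subKr g); apply: lspaceB => //; apply: V_a.
Qed.

Lemma image_homog_ideal : is_homog_ideal (quot_gr a) [set \pi_Q f | f in V].
Proof.
split.
  split; first by exists 0; rewrite ?rmorph0 //; case: VS.
  move=> x _ _ [f Vf <-] [g Vg <-]; exists (repr x * f + g).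
    by apply: lspaceD => //; apply: mulX_closed_mul.
  by rewrite rmorphD rmorphM /= reprK.
move=> _ [f Vf <-]; exists (msize f), (fun i => \pi_Q (pihomog mdeg i f)).
split.
  move=> i; split; first by exists (pihomog mdeg i f) => //; apply: V_homog.
  by exists (pihomog mdeg i f) => //=; apply: pihomogP.
by rewrite {1}(pihomog_partitionE (leqnn (msize f))) raddf_sum.
Qed.

Lemma hilb_image d : hilb (quot_gr a) [set \pi_Q f | f in V] d =
  (\sum_(m <- monos n d) (`[< lead_of (piece V d) m >] && ('X_[m] \notin a)))%N.
Proof.
rewrite hilb_leads; last by case: image_homog_ideal.
suff VE : lift_set [set \pi_Q f | f in V] = V by rewrite /std_leads VE.
by apply/seteqP; split=> f /lift_image.
Qed.

End HomogeneousIdeal.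

End Quotient.
End LeadingMonomials.

(** * Flags attached to an embedding *)

Lemma sum_eq_sub (T : eqType) (s : seq T) (P Q : pred T) : {subset P <= Q} ->
  (\sum_(x <- s) P x = \sum_(x <- s) Q x)%N -> forall x, x \in s -> Q x -> P x.
Proof.
move=> PQ eqPQ x xs Qx; apply: contrapT => /negP Px; move: eqPQ; apply/eqP.
rewrite neq_ltn !(perm_big _ (perm_to_rem xs)) !big_cons /= Qx (negPf Px).
rewrite add0n add1n ltnS leq_sum // => y _; case: (boolP (P y)) => // /PQ.
by rewrite unfold_in => ->.
Qed.

Lemma sum_sub_exists (T : eqType) (s : seq T) (P : pred T) h : uniq s ->
  (h <= \sum_(x <- s) P x)%N ->
  exists2 Q : pred T, {subset Q <= P} & (\sum_(x <- s) Q x = h)%N.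
Proof.
move=> s_uniq; have sumE (Q : pred T) : (\sum_(x <- s) Q x)%N = size (filter Q s).
  by rewrite size_filter -sum1_count [RHS]big_mkcond.
rewrite sumE => h_le; exists (mem (take h (filter P s))).
  by move=> x /mem_take; rewrite mem_filter => /andP[].
rewrite (sumE (mem _)) -[RHS](size_takel h_le).
apply/perm_size/uniq_perm; rewrite ?filter_uniq ?take_uniq ?filter_uniq //.
move=> x; rewrite mem_filter; apply: andb_idr => /mem_take.
by rewrite mem_filter => /andP[].
Qed.

Section Flags.
Variables (k : fieldType) (n : nat) (a : idealr {mpoly k[n]}).
Local Notation A := {mpoly k[n]}.
Local Notation Q := {ideal_quot a}.
Local Notation gr := (quot_gr a).
Hypothesis a_mono : forall f : A, f \in a -> forall m, m \in msupp f -> 'X_[m] \in a.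
Implicit Types (m u v : 'X_{1..n}) (M : pred 'X_{1..n}).

Definition nonzero : pred 'X_{1..n} := fun m => ('X_[m] : A) \notin a.

Definition hdim e := (\sum_(m <- monos n e) nonzero m)%N.

Definition count_deg e M := (\sum_(m <- monos n e) M m)%N.

Lemma nonzero_down u v : (u <= v)%MM -> nonzero v -> nonzero u.
Proof.
by move=> /submK <-; apply: contraNN => ua; rewrite mpolyXD idealMr.
Qed.

Definition mono_space (P : 'X_{1..n} -> Prop) : set A :=
  [set f | forall m, m \in msupp f -> P m].

Lemma mono_spaceX P m : mono_space P 'X_[m] <-> P m.
Proof.
split=> [|Pm u]; first by apply; rewrite msuppX inE.
by rewrite msuppX inE => /eqP ->.
Qed.

Lemma mono_space_lspace P : lspace (mono_space P).
Proof.
split=> [m|c f g Pf Pg m]; first by rewrite msupp0.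
move=> /msuppD_le; rewrite mem_cat => /orP[/msuppZ_le|]; [exact: Pf|exact: Pg].
Qed.

Lemma lead_mono_space P d m :
  lead_of (piece (mono_space P) d) m <-> mdeg m = d /\ P m.
Proof.
split=> [Lm|[md Pm]].
  split; first exact: lead_of_piece Lm.
  by case: Lm => f [[Pf _] f0 <-]; apply: Pf; apply: mlead_supp.
exists 'X_[m]; split; last exact: mleadXm.
  by split; [apply/mono_spaceX | rewrite /= dhomogX; apply/eqP].
by rewrite -msupp_eq0 msuppX.
Qed.

Section MonomialIdeal.
Variable P : 'X_{1..n} -> Prop.
Hypothesis P_up : forall m i, P m -> P (m + U_(i))%MM.
Hypothesis P_a : forall m, ~~ nonzero m -> P m.

Lemma mono_space_X f i : mono_space P f -> mono_space P ('X_i * f).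
Proof.
move=> Pf m /msuppM_le /allpairsP[[u v] /= [+ vf ->]].
by rewrite msuppX inE => /eqP ->; rewrite addmC; apply/P_up/Pf.
Qed.

Lemma mono_space_homog f d : mono_space P f -> mono_space P (pihomog mdeg d f).
Proof.
move=> Pf; rewrite pihomogE big_seq_cond; apply: big_ind.
- by case: (mono_space_lspace P).
- by move=> x y; exact: (lspaceD (mono_space_lspace P)).
move=> m /andP[mf _]; apply: (lspaceZ _ (mono_space_lspace P)).
exact/mono_spaceX/Pf.
Qed.

Lemma mono_space_a f : f \in a -> mono_space P f.
Proof. by move=> fa m /(a_mono fa) ma; apply: P_a; rewrite /nonzero ma. Qed.

Lemma hilb_series_mono :
  hilb_series gr (fun d => \sum_(m <- monos n d) (`[< P m >] && nonzero m))%N.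
Proof.
exists [set \pi_Q f | f in mono_space P].
  apply: image_homog_ideal; first exact: mono_space_lspace.
  - exact: mono_space_X.
  - exact: mono_space_homog.
apply: funext => d; rewrite hilb_image //; first last.
- exact: mono_space_a.
- exact: mono_space_homog.
- exact: mono_space_X.
- exact: mono_space_lspace.
rewrite big_seq_cond [RHS]big_seq_cond; apply: eq_bigr => m.
rewrite mem_monos => /andP[/eqP md _]; congr (nat_of_bool (_ && _)).
by apply/asboolP/asboolP; rewrite lead_mono_space // => -[].
Qed.

End MonomialIdeal.

Definition grows e h h' := exists M M' : pred 'X_{1..n},
  [/\ {subset M <= nonzero}, {subset M' <= nonzero},
      forall u i, mdeg u = e -> M u -> nonzero (u + U_(i))%MM -> M' (u + U_(i))%MM
    & count_deg e M = h /\ count_deg e.+1 M' = h'].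

(** The least h' with grows e h h'. The search stops at hdim e.+1, which is
    always possible: all nonzero monomials of degree e+1. *)
Definition growth e h := find (fun h' => `[< grows e h h' >]) (iota 0 (hdim e.+1)).

Lemma growth_hdim e h : (growth e h <= hdim e.+1)%N.
Proof. by rewrite -[leqRHS](size_iota 0); apply: find_size. Qed.

Lemma growth_le e h h' : grows e h h' -> (growth e h <= h')%N.
Proof.
move=> gr_h; rewrite leqNgt; apply/negP => lt_h'.
have := before_find 0 lt_h'; rewrite nth_iota ?add0n.
  by move/asboolP; apply.
exact: leq_trans lt_h' (growth_hdim _ _).
Qed.

Lemma grows_growth e h : (h <= hdim e)%N -> grows e h (growth e h).
Proof.
move=> h_le; rewrite /growth; set p := fun h' => _.
have [has_p|no_p] := boolP (has p (iota 0 (hdim e.+1))).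
  have := nth_find 0 has_p; rewrite nth_iota ?add0n; first by move/asboolP.
  by move: has_p; rewrite has_find size_iota.
rewrite hasNfind // size_iota.
have [M M_nz cM] := sum_sub_exists (monos_uniq n e) h_le.
by exists M, nonzero; split.
Qed.

Lemma growth0 e : growth e 0 = 0%N.
Proof.
apply/eqP; rewrite -leqn0; apply: growth_le; exists pred0, pred0.
by split=> //; split; rewrite /count_deg big1.
Qed.

Lemma growth_mono e h h' : (h <= h')%N -> (h' <= hdim e)%N ->
  (growth e h <= growth e h')%N.
Proof.
move=> le_h /grows_growth [M [M' [Mn M'n MM' [cM cM']]]].
apply: growth_le; rewrite -cM in le_h.
have [M0 M0M cM0] := sum_sub_exists (monos_uniq n e) le_h.
exists M0, M'; split=> // [u /M0M|u i ue /M0M]; [exact: Mn | exact: MM'].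
Qed.

(** For h' = hdim e.+1 this is the largest Hilbert function with value h in degree
    e that vanishes below e. *)
Definition step_series e h h' d :=
  if (d < e)%N then 0%N else if d == e then h else
  if d == e.+1 then h' else hdim d.

(** The ideal is spanned by M in degree e, M' in degree e+1 and all monomials
    of larger degree. *)
Lemma step_series_hilb e h h' : grows e h h' -> hilb_series gr (step_series e h h').
Proof.
move=> [M [M' [Mn M'n MM' [cM cM']]]].
pose P m := [\/ ~~ nonzero m, mdeg m = e /\ M m, mdeg m = e.+1 /\ M' m | (e.+1 < mdeg m)%N].
have P_up m i : P m -> P (m + U_(i))%MM.
  have [nz|nz _] := boolP (nonzero (m + U_(i))%MM); last by constructor 1.
  rewrite /P mdegD mdeg1 addn1; case=> [|[me Mm]|[me Mm]|lt_m].
  - by rewrite (nonzero_down (lem_addr _ _) nz).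
  - by constructor 3; rewrite me; split=> //; apply: MM'.
  - by constructor 4; rewrite me.
  - by constructor 4; lia.
have := hilb_series_mono P_up; move=> /(_ (fun m nz => Or41 _ _ _ nz)).
congr (hilb_series gr _); apply: funext => d; rewrite /step_series.
have sumE (F : pred 'X_{1..n}) : (forall m, mdeg m = d -> (`[< P m >] && nonzero m) = F m) ->
    (\sum_(m <- monos n d) (`[< P m >] && nonzero m) = count_deg d F)%N.
  move=> PF; rewrite big_seq_cond [RHS]big_seq_cond; apply: eq_bigr => m.
  by rewrite mem_monos => /andP[/eqP /PF -> _].
case: ltnP => [d_e|e_d].
  rewrite (sumE pred0) ?/count_deg ?big1 // => m md.
  by apply/andP => -[/asboolP]; rewrite /P md; case=> [/negPf ->//|||] *; lia.
case: eqP => [dE|d_e].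
  rewrite (sumE M) ?dE // => m md; apply/andP/idP => [[/asboolP + nz]|Mm].
    by rewrite /P md; case=> [|[]|[]|]; rewrite ?nz //; lia.
  by split; [apply/asboolP; constructor 2; rewrite md | apply: Mn].
case: eqP => [dE|d_e1].
  rewrite (sumE M') ?dE // => m md; apply/andP/idP => [[/asboolP + nz]|Mm].
    by rewrite /P md; case=> [|[]|[]|]; rewrite ?nz //; lia.
  by split; [apply/asboolP; constructor 3; rewrite md | apply: M'n].
rewrite (sumE nonzero) // => m md; apply: andb_idl => _; apply/asboolP.
by constructor 4; rewrite md; lia.
Qed.

Lemma grows_hdim e h : (h <= hdim e)%N -> grows e h (hdim e.+1).
Proof.
move=> /(sum_sub_exists (monos_uniq n e)) [M Mn cM].
by exists M, nonzero; split.
Qed.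

Lemma hilb_eq_sub (J J' : set Q) d : is_ideal J -> is_ideal J' -> J `<=` J' ->
  hilb gr J d = hilb gr J' d ->
  piece (lift_set J') d `<=` piece (lift_set J) d.
Proof.
move=> JI J'I JJ'; rewrite !hilb_leads // => eqJ.
apply: lead_sub.
- exact/piece_lspace/lift_set_lspace.
- exact/piece_lspace/lift_set_lspace.
- by move=> f [/JJ' ? ?]; split.
move=> m J'm; have md := lead_of_piece J'm.
have [nz|/negPn ma] := boolP (nonzero m).
  have : std_leads J d m.
    apply: (sum_eq_sub _ eqJ); last by apply/andP; split=> //; apply/asboolP.
      move=> u /andP[/asboolP [f [[Jf fd] f0 fu]] nzu]; apply/andP; split=> //.
      by apply/asboolP; exists f; split=> //; split=> //; apply: JJ'.
    by rewrite mem_monos md.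
  by case/andP => /asboolP.
exists 'X_[m]; split; last exact: mleadXm.
  by split; [apply: lift_set_ideal | rewrite /= dhomogX; apply/eqP].
by rewrite -msupp_eq0 msuppX.
Qed.

(** Flags of subspaces of the R_e, given by their preimages in A_e, that grow
    under multiplication by R_1 as slowly as sets of monomials can. *)
Definition flags (L : nat -> nat -> set A) :=
  [/\ forall e h, (h <= hdim e)%N ->
        [/\ lspace (L e h), forall f, L e h f -> f \is e.-homog
          & forall f, f \in a -> f \is e.-homog -> L e h f],
      forall e h, (h <= hdim e)%N ->
        (\sum_(m <- monos n e) (`[< lead_of (L e h) m >] && nonzero m) = h)%N,
      forall e h h', (h <= h')%N -> (h' <= hdim e)%N -> L e h `<=` L e h'
    & forall e h i f, (h <= hdim e)%N ->
        L e h f -> L e.+1 (growth e h) ('X_i * f)].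

(** L e h is the degree e part of the ideal embedded for the function that is 0
    below e, h at e and maximal above. For a monomial set of size h with growth
    h', the ideal embedded for (0, h, h', maximal) lies in the one defining
    L e h and contains the one defining L (e+1) h'. Equality of dimensions makes
    all of these agree in the degrees concerned, so that the inclusion
    of R_1 (L e h) in L (e+1) h' is closure of a single ideal under R_1. *)
Lemma embedding_flags : admits_embedding gr -> exists L, flags L.
Proof.
move=> [eps [eps_ideal eps_mono _ eps_hilb]].
pose H e h := step_series e h (hdim e.+1).
have HP e h : (h <= hdim e)%N -> hilb_series gr (H e h).
  by move=> /grows_hdim /step_series_hilb.
have epsI S : hilb_series gr S -> is_ideal (eps S) by move=> /eps_ideal [].
have He e h h' : step_series e h h' e = h by rewrite /step_series ltnn eqxx.
have He1 e h h' : step_series e h h' e.+1 = h'.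
  by rewrite /step_series ltnNge leqnSn eqn_leq ltnn eqxx.
exists (fun e h => piece (lift_set (eps (H e h))) e); split.
- move=> e h /HP hP; have I := epsI _ hP; split.
  + exact/piece_lspace/lift_set_lspace.
  + by move=> f [].
  + by move=> f fa fe; split=> //; apply: lift_set_ideal.
- move=> e h /HP hP; have := hilb_leads a_mono e (epsI _ hP).
  by rewrite eps_hilb // /H He => {2}->.
- move=> e h h' le_h h'_le f [Lf fe]; split=> //.
  apply: eps_mono Lf; [exact/HP/(leq_trans le_h)|exact: HP|] => d.
  by rewrite /H /step_series; case: ifP => // _; case: ifP.
move=> e h i f h_le [Lf fe].
have g_le := growth_hdim e h; have gP := grows_growth h_le.
set h' := growth e h in g_le gP *.
have S2 := step_series_hilb gP; set H2 := step_series e h h' in S2.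
have Se := HP e h h_le; have Se1 := HP e.+1 h' g_le.
have [I2 Ie Ie1] := And3 (epsI _ S2) (epsI _ Se) (epsI _ Se1).
(* H2 is below the function defining L e h and above that defining L e.+1 h'. *)
have sub1 : eps H2 `<=` eps (H e h).
  apply: eps_mono => // d; rewrite /H2 /H /step_series.
  by case: ifP => // _; case: ifP => // _; case: eqP => // ->.
have sub2 : eps (H e.+1 h') `<=` eps H2.
  apply: eps_mono => // d; rewrite /H2 /H /step_series ltnS.
  case: (leqP d e) => // e_d; rewrite ltnNge (ltnW e_d) (gtn_eqF e_d) /=.
  by case: eqP => // _; case: eqP => // ->.
have [E2f _] : piece (lift_set (eps H2)) e f.
  by apply: (hilb_eq_sub I2 Ie sub1) => //; rewrite !eps_hilb // /H2 /H !He.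
apply: (hilb_eq_sub Ie1 I2 sub2); first by rewrite !eps_hilb // /H2 /H He He1.
split; first exact: lift_setM.
by apply: (dhomogM (d := 1)) => //; rewrite dhomogX; apply/eqP/mdeg1.
Qed.

End Flags.

(** * The extended quotient *)

(** The polynomials all of whose monomials lie in a form an ideal that contains
    the generating monomials of a. *)
Lemma monomial_idealP (k : fieldType) n (a : idealr {mpoly k[n]}) :
  is_monomial_ideal [set` a] ->
  forall f : {mpoly k[n]}, f \in a -> forall m, m \in msupp f -> 'X_[m] \in a.
Proof.
move=> [M aE] f fa; have : ideal_gen [set 'X_[m] | m in M] f by rewrite -aE.
pose P (m : 'X_{1..n}) := ('X_[m] : {mpoly k[n]}) \in a.
apply: (_ : ideal_gen _ `<=` mono_space P); apply: smallest_sub.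
  split=> [m|g u v Pu Pv]; first by rewrite msupp0.
  apply: (lspaceD (mono_space_lspace k P)) => //.
  apply: (mulX_closed_mul (mono_space_lspace k P)) => // h i; apply: mono_space_X => m j.
  by rewrite /P mpolyXD mulrC; apply: idealMr.
move=> _ [m Mm <-]; apply/mono_spaceX; rewrite /P.
suff : [set` a] 'X_[m] by [].
by rewrite aE => J [_]; apply; exists m.
Qed.

Section Split.
Variable n : nat.
Implicit Types (u v : 'X_{1..n}) (m : 'X_{1..n.+1}).

(** The monomial u z^j of B. *)
Definition zmono u j : 'X_{1..n.+1} := (mnmwiden u + U_(ord_max) *+ j)%MM.

Definition xpart m : 'X_{1..n} := [multinom m (widen_ord (leqnSn n) i) | i < n].

Lemma ord_maxVwiden (P : 'I_n.+1 -> Prop) :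
  P ord_max -> (forall i : 'I_n, P (widen_ord (leqnSn n) i)) -> forall i, P i.
Proof.
move=> Pmax Pw i; case: (unliftP ord_max i) => [j ->|-> //].
by rewrite (_ : lift _ _ = widen_ord (leqnSn n) j) //; apply/val_inj; rewrite [LHS]lift_max.
Qed.

Lemma widenNmax (i : 'I_n) : (ord_max == widen_ord (leqnSn n) i) = false.
Proof. by apply/negbTE; rewrite -val_eqE /= neq_ltn ltn_ord orbT. Qed.

Lemma zmono_max u j : zmono u j ord_max = j.
Proof. by rewrite mnmDE mnmwiden_ordmax mulmnE mnm1E eqxx mul1n. Qed.

Lemma zmono_widen u j i : zmono u j (widen_ord (leqnSn n) i) = u i.
Proof. by rewrite mnmDE mnmwiden_widen mulmnE mnm1E widenNmax addn0. Qed.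

Lemma xpart_zmono u j : xpart (zmono u j) = u.
Proof. by apply/mnmP => i; rewrite mnmE zmono_widen. Qed.

Lemma zmono_xpart m : zmono (xpart m) (m ord_max) = m.
Proof.
apply/mnmP; apply: ord_maxVwiden => [|i]; first by rewrite zmono_max.
by rewrite zmono_widen mnmE.
Qed.

Lemma zmono_inj u v j : zmono u j = zmono v j -> u = v.
Proof. by move/(congr1 xpart); rewrite !xpart_zmono. Qed.

Lemma zmonoS u j : zmono u j.+1 = (zmono u j + U_(ord_max))%MM.
Proof. by rewrite /zmono mulmSr addmA. Qed.

Lemma zmonoDr u i j : zmono u (i + j)%N = (zmono u i + U_(ord_max) *+ j)%MM.
Proof. by apply/mnmP => l; rewrite !mnmDE !mulmnE mulnDr addnA. Qed.

Lemma zmonoD u i j : zmono (u + U_(i)) j = (zmono u j + U_(widen_ord (leqnSn n) i))%MM.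
Proof. by rewrite /zmono mnmwidenD mnmwiden1 -!addmA; congr (_ + _)%MM; rewrite addmC. Qed.

Lemma mdeg_zmono u j : mdeg (zmono u j) = (mdeg u + j)%N.
Proof.
rewrite mdegE big_ord_recr /= zmono_max mdegE; congr (_ + _)%N.
by apply: eq_bigr => i _; apply: zmono_widen.
Qed.

(** Monomials are compared by degree first, then by the exponents from the
    first variable on, and z is the last variable. *)
Lemma zmono_lt u v j : (u < v)%O -> (zmono u j < zmono v j)%O.
Proof.
move=> lt_uv; have := lemc_mdeg (ltW lt_uv).
rewrite leq_eqVlt => /predU1P[eq_uv|lt_deg]; last first.
  by apply: lt_mdeg_ltmc; rewrite !mdeg_zmono ltn_add2r.
case/(ltmcP eq_uv): lt_uv => i eq_i lt_i; apply/ltmcP.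
  by rewrite !mdeg_zmono eq_uv.
exists (widen_ord (leqnSn n) i); last by rewrite !zmono_widen.
apply: ord_maxVwiden => [|l] /=; first by rewrite ltnNge (ltnW (ltn_ord i)).
by move=> /eq_i; rewrite !zmono_widen.
Qed.

Lemma zmono_le u v j : (zmono u j <= zmono v j)%O -> (u <= v)%O.
Proof. by apply: contraTT; rewrite -!ltNge; apply: zmono_lt. Qed.

Lemma zmono_le_mono u v j : (u <= v)%O -> (zmono u j <= zmono v j)%O.
Proof. by rewrite !le_eqVlt => /predU1P[->|/zmono_lt ->]; rewrite ?eqxx ?orbT. Qed.

Lemma sum_zmono d (F : 'X_{1..n.+1} -> nat) : (\sum_(m <- monos n.+1 d) F m =
  \sum_(u <- monosle n d) F (zmono u (d - mdeg u)%N))%N.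
Proof.
rewrite -(big_map (fun u => zmono u (d - mdeg u)%N) xpredT).
apply: perm_big; apply: uniq_perm; first exact: monos_uniq.
  rewrite map_inj_uniq ?monosle_uniq // => u v /(congr1 xpart).
  by rewrite !xpart_zmono.
move=> m; rewrite mem_monos; apply/eqP/mapP => [md|[u + ->]]; last first.
  by rewrite mem_monosle mdeg_zmono => u_d; rewrite subnKC.
have mE : (mdeg (xpart m) + m ord_max = d)%N by rewrite -mdeg_zmono zmono_xpart.
exists (xpart m); first by rewrite mem_monosle -mE leq_addr.
by rewrite -mE addKn zmono_xpart.
Qed.

End Split.

Section Extension.
Variables (k : fieldType) (n : nat) (t : option nat) (t_gt0 : pos_exponent t).
Variable a : idealr {mpoly k[n]}.
Hypothesis a_mono :
  forall f : {mpoly k[n]}, f \in a -> forall m, m \in msupp f -> 'X_[m] \in a.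
Hypothesis a_pow : forall i : 'I_n, exprt ('X_i : {mpoly k[n]}) t \in a.
Local Notation A := {mpoly k[n]}.
Local Notation B := {mpoly k[n.+1]}.
Local Notation b := (ext_ideal a t_gt0).
Local Notation nza := (nonzero a).
Local Notation hdima := (hdim a).
Local Notation growtha := (growth a).

Lemma below0 : below t 0.
Proof. by case: t t_gt0. Qed.

(** The exponents of a nonzero monomial obey the bound imposed on z, because
    x_i^t is in a. *)
Lemma nonzero_below u i : nza u -> below t (u i).
Proof.
case: t (a_pow i) => [e|] //= Xe; apply: contraNT; rewrite -leqNgt => e_u.
have -> : u = (u - U_(i) *+ e + U_(i) *+ e)%MM.
  rewrite submK //; apply/mnm_lepP => j; rewrite mulmnE mnm1E.
  by case: eqP => [<-|]; rewrite ?mul1n.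
by rewrite mpolyXD -mpolyXn idealMr.
Qed.

Definition ext_mono (m : 'X_{1..n.+1}) :=
  ~~ (below t (m ord_max) && nza (xpart m)).

Lemma ext_monoD m i : ext_mono m -> ext_mono (m + U_(i))%MM.
Proof.
apply: contraNN => /andP[bm nm]; apply/andP; split.
  by apply: below_leq bm; rewrite mnmDE leq_addr.
apply: nonzero_down nm; apply/mnm_lepP => j.
by rewrite !mnmE leq_addr.
Qed.

(** The right-hand side is an ideal containing the generators of (aB, z^t). *)
Lemma ext_sub (F : B) : F \in b -> mono_space ext_mono F.
Proof.
move=> /asboolP; apply: (_ : ideal_gen _ `<=` _); apply: smallest_sub.
  split=> [m|g u v Pu Pv]; first by rewrite msupp0.
  apply: (lspaceD (mono_space_lspace k ext_mono)) => //.
  apply: (mulX_closed_mul (mono_space_lspace k ext_mono)) => // h i; apply: mono_space_X.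
  exact: ext_monoD.
move=> _ [[f fa <-]|->].
  rewrite [f]mpolyE raddf_sum /= big_seq; apply: big_ind.
  - by case: (mono_space_lspace k ext_mono).
  - by move=> x y; apply: (lspaceD (mono_space_lspace k ext_mono)).
  move=> u uf; rewrite mwidenZ mwidenX.
  apply: (lspaceZ _ (mono_space_lspace k ext_mono)); apply/mono_spaceX.
  rewrite /ext_mono -[mnmwiden u]addm0 -(mulm0n U_(ord_max)) -/(zmono u 0).
  by rewrite xpart_zmono negb_and [nza u]/nonzero (a_mono fa uf) orbT.
rewrite /ext_mono; case: (t) => [e|] /=; last first.
  by case: (mono_space_lspace k (fun m => ~~ (true && nza (xpart m)))).
rewrite mpolyXn; apply/mono_spaceX.
by rewrite mulmnE mnm1E eqxx mul1n ltnn.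
Qed.

Lemma ext_monoP m : ('X_[m] : B) \in b = ext_mono m.
Proof.
apply/idP/idP => [/ext_sub /mono_spaceX //|].
rewrite /ext_mono negb_and -{3}(zmono_xpart m) => /orP[zt|xa].
  have [e [te e_m]] : exists e, t = Some e /\ (e <= m ord_max)%N.
    by case: (t) zt => // e; rewrite -leqNgt; exists e.
  have zb : ('X_ord_max : B) ^+ e \in b.
    by apply/asboolP => J [_]; apply; right; rewrite te.
  by rewrite -(subnK e_m) zmonoDr mpolyXD -mpolyXn; apply: idealMr.
rewrite /zmono mpolyXD mulrC idealMr // -mwidenX.
apply/asboolP => J [_]; apply; left; exists 'X_[xpart m] => //.
exact/negPn.
Qed.

Lemma nonzero_ext u j : nonzero b (zmono u j) = below t j && nza u.
Proof. by rewrite /nonzero ext_monoP negbK zmono_max xpart_zmono. Qed.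

Lemma b_mono (F : B) : F \in b -> forall m, m \in msupp F -> 'X_[m] \in b.
Proof. by move=> /ext_sub Fb m /Fb; rewrite -ext_monoP. Qed.

Section Reduction.
Variable J : set {ideal_quot b}.
Hypothesis JI : is_ideal J.

(** The standard leading monomials of J in degree d, coded by their part in
    the variables of A. *)
Definition coded_leads d : pred 'X_{1..n} := fun u =>
  (mdeg u <= d)%N && std_leads J d (zmono u (d - mdeg u)%N).

Lemma coded_leads_std d u : coded_leads d u -> std t nza d u.
Proof.
case/andP => u_d /andP[_]; rewrite -/(nonzero b _) nonzero_ext => /andP[bu nu].
by rewrite /std u_d nu bu.
Qed.

Lemma coded_leads_shadow d :
  shadow t nza d (coded_leads d) (coded_leads d.+1).
Proof.
move=> u /andP[u_d Ju]; split=> [/and3P[u_d1 nu bu]|i /and3P[ui_d nu bu]].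
  rewrite /coded_leads u_d1 subSn // zmonoS; apply: std_leads_mulX => //.
  by rewrite -zmonoS -subSn // -/(nonzero b _) nonzero_ext bu nu.
rewrite /coded_leads ui_d /=; have dE : (d.+1 - mdeg (u + U_(i)) = d - mdeg u)%N.
  by rewrite mdegD mdeg1 addn1 subSS.
rewrite dE zmonoD; apply: std_leads_mulX => //.
by rewrite -zmonoD -/(nonzero b _) nonzero_ext nu andbT -dE.
Qed.

Lemma hilb_coded d :
  hilb (quot_gr b) J d = (\sum_(u <- monosle n d) coded_leads d u)%N.
Proof.
rewrite (hilb_leads b_mono) // sum_zmono big_seq [RHS]big_seq.
by apply: eq_bigr => u; rewrite mem_monosle /coded_leads => ->.
Qed.

(** Compress the coded leading monomials of J in degrees d and d+1, and let v j
    count those of degree d with z-exponent j. Compression makes v stable, and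
    the compressed set of degree d+1 contains the shadow of that of degree d. *)
Lemma hilb_stable d : exists2 v, stable t hdima growtha d v &
  total d v = hilb (quot_gr b) J d /\
  (total d.+1 (shift t growtha d v) <= hilb (quot_gr b) J d.+1)%N.
Proof.
have [M1 [M1' [M1s M1's sh xs [c1 c1']]]] :=
  exists_xstable (@nonzero_down _ _ a) nonzero_below (ltnSn d.+1)
    (@coded_leads_std d) (@coded_leads_std d.+1) (@coded_leads_shadow d).
pose v j := if (j <= d)%N then count_deg (d - j)%N M1 else 0%N.
have vE j : (j <= d)%N -> v j = count_deg (d - j)%N M1 by rewrite /v => ->.
exists v; last split.
- split=> j; rewrite /v.
    case: (leqP j d) => // j_d; rewrite /cap j_d /=; case: ifP => bj.
      apply: leq_sum => u _; case: (boolP (M1 u)) => // /M1s /and3P[_ + _].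
      by case: (nza u).
    rewrite /count_deg big_seq big1 // => u; rewrite mem_monos => /eqP ud.
    case: (boolP (M1 u)) => // /M1s /and3P[_ _].
    by rewrite ud subKn ?bj.
  case: (ltnP j d) => [j_d|_]; last by rewrite growth0.
  rewrite (ltnW j_d); apply: growth_le; exists M1, M1; split=> //.
  + by move=> u /M1s /and3P[].
  + by move=> u /M1s /and3P[].
  + by move=> u i ud M1u; apply: xs => //; lia.
  by split=> //; rewrite -subSn // subSS.
- rewrite hilb_coded -c1 sum_monosle; apply: eq_bigr => j _.
  by rewrite vE // leq_ord.
rewrite hilb_coded -c1' sum_monosle /total big_ord_recl [leqRHS]big_ord_recl.
apply: leq_add => /=.
  rewrite vE // !subn0; apply: growth_le; exists M1, M1'; split=> //.
  + by move=> u /M1s /and3P[].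
  + by move=> u /M1's /and3P[].
  move=> u i ud M1u nu; apply: (sh _ M1u).2.
  by rewrite /std nu mdegD mdeg1 ud addn1 subnn leqnn below0.
apply: leq_sum => j _; rewrite /bump leq0n add1n subSS.
case: ifP => // bj; rewrite vE ?leq_ord //.
rewrite /count_deg big_seq [leqRHS]big_seq; apply: leq_sum => u.
rewrite mem_monos => /eqP ud; case: (boolP (M1 u)) => // M1u.
rewrite (sh _ M1u).1 //; have /and3P[u_d nu _] := M1s _ M1u.
rewrite /std nu leqW //= ud subSn ?leq_subr // subKn ?leq_ord //.
Qed.

End Reduction.

Definition seg d h : nat -> nat :=
  xget (fun=> 0%N) [set p | segment t hdima growtha d p /\ total d p = h].

Definition hcap d := total d (cap t hdima d).

(** The condition under which the flag sums attached to the segments of totals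
    H d form an ideal. *)
Definition admissible (H : nat -> nat) := forall d, (H d <= hcap d)%N /\
  (total d.+1 (shift t growtha d (seg d (H d))) <= H d.+1)%N.

Let g_le e h (_ : (h <= hdima e)%N) : (growtha e h <= hdima e.+1)%N := growth_hdim a e h.

Lemma segP d h : (h <= hcap d)%N ->
  segment t hdima growtha d (seg d h) /\ total d (seg d h) = h.
Proof.
move=> /(segment_exists (@growth0 _ _ a) (@growth_mono _ _ a) g_le) [p pP pE].
rewrite /seg; case: xgetP => [q _ []//|/(_ p)].
by case.
Qed.

Lemma hilb_admissible H : hilb_series (quot_gr b) H -> admissible H.
Proof.
move=> [J [JI _] <-] d; have [v vS [vE shv]] := hilb_stable JI d.
have H_le : (hilb (quot_gr b) J d <= hcap d)%N.
  by rewrite -vE; apply: total_mono; case: vS.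
split=> //; apply: leq_trans shv; have [segS segE] := segP H_le.
apply: segment_min_growth segS vS _ => //; first exact: growth_mono.
by rewrite segE.
Qed.

(** The degree e part of the coefficient of z^j in F. *)
Definition comp e j (F : B) : A := \sum_(u <- monos n e) F@_(zmono u j) *: 'X_[u].

Lemma mcoeff_comp e j F u :
  (comp e j F)@_u = if mdeg u == e then F@_(zmono u j) else 0.
Proof.
rewrite /comp raddf_sum /=; case: ifP => ue.
  have us : u \in monos n e by rewrite mem_monos.
  rewrite (perm_big _ (perm_to_rem us)) big_cons /= mcoeffZ mcoeffX eqxx mulr1.
  rewrite big_seq big1 ?addr0 // => v; rewrite mem_rem_uniq ?monos_uniq //.
  by rewrite inE => /andP[/negPf vu _]; rewrite mcoeffZ mcoeffX vu mulr0.
rewrite big_seq big1 // => v; rewrite mem_monos mcoeffZ mcoeffX => ve.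
by case: eqP => [vu|_]; [rewrite -vu ve in ue | rewrite mulr0].
Qed.

Lemma comp_homog e j F : comp e j F \is e.-homog.
Proof.
apply/dhomogP => u; rewrite mcoeff_msupp mcoeff_comp.
by case: (mdeg u =P e) => // _; rewrite eqxx.
Qed.

Lemma comp_lin e j c F G : comp e j (c *: F + G) = c *: comp e j F + comp e j G.
Proof.
apply/mpolyP => u; rewrite mcoeffD mcoeffZ !mcoeff_comp mcoeffD mcoeffZ.
by case: ifP => // _; rewrite mulr0 addr0.
Qed.

Lemma mcoeffXM N (G : {mpoly k[N]}) i m : ('X_i * G)@_(m + U_(i)) = G@_m.
Proof. by rewrite mulrC addmC mcoeffMX. Qed.

Lemma mcoeffXM0 N (G : {mpoly k[N]}) i (m : 'X_{1..N}) : m i = 0%N -> ('X_i * G)@_m = 0.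
Proof.
move=> mi; apply: memN_msupp_eq0; apply/negP; rewrite mulrC.
rewrite (perm_mem (msuppMX _ _)) => /mapP[v _ mE].
by move: mi; rewrite mE mnmDE mnm1E eqxx.
Qed.

Lemma comp_zS e j F : comp e j.+1 ('X_ord_max * F) = comp e j F.
Proof.
by apply/mpolyP => u; rewrite !mcoeff_comp zmonoS mcoeffXM.
Qed.

Lemma comp_z0 e F : comp e 0 ('X_ord_max * F) = 0.
Proof.
apply/mpolyP => u; rewrite mcoeff_comp mcoeff0 mcoeffXM0 ?if_same //.
exact: zmono_max.
Qed.

Lemma comp_xS e j i F : comp e.+1 j ('X_(widen_ord (leqnSn n) i) * F) = 'X_i * comp e j F.
Proof.
apply/mpolyP => u; rewrite mcoeff_comp; have [ui|ui] := eqVneq (u i) 0%N.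
  by rewrite !mcoeffXM0 ?zmono_widen ?if_same.
have -> : u = (u - U_(i) + U_(i))%MM by rewrite submK // lep1mP.
by rewrite mdegD mdeg1 addn1 eqSS zmonoD !mcoeffXM mcoeff_comp.
Qed.

Lemma comp_x0 j i F : comp 0 j ('X_(widen_ord (leqnSn n) i) * F) = 0.
Proof.
apply/mpolyP => u; rewrite mcoeff_comp mcoeff0; case: eqP => // /eqP.
by rewrite mdeg_eq0 => /eqP ->; rewrite mcoeffXM0 // zmono_widen mnm0E.
Qed.

Lemma mcoeff_pihomog N (G : {mpoly k[N]}) d m :
  (pihomog mdeg d G)@_m = if mdeg m == d then G@_m else 0.
Proof.
case: eqP => [md|/eqP md]; last exact: dhomog_nemf_coeff (pihomogP _ _ _) md.
(* The bound must exceed d, even when G has smaller degree. *)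
have le_K : (msize G <= maxn (msize G) d.+1)%N by apply: leq_maxl.
have -> : G@_m = \sum_(i < maxn (msize G) d.+1) (pihomog mdeg i G)@_m.
  by rewrite {1}(pihomog_partitionE le_K) raddf_sum.
have dK : (d < maxn (msize G) d.+1)%N by rewrite leq_max ltnSn orbT.
rewrite (bigD1 (Ordinal dK)) //= big1 ?addr0 // => i id.
have mi : mdeg m != i by rewrite md eq_sym; exact: id.
exact: dhomog_nemf_coeff (pihomogP _ _ _) mi.
Qed.

Lemma comp_pihomog e j d F :
  comp e j (pihomog mdeg d F) = if (e + j == d)%N then comp e j F else 0.
Proof.
apply/mpolyP => u; rewrite mcoeff_comp mcoeff_pihomog mdeg_zmono.
case: (e + j =P d)%N => [ejd|ejd]; rewrite ?mcoeff_comp ?mcoeff0.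
  by case: eqP => // ->; rewrite ejd eqxx.
by case: eqP => // ->; case: eqP.
Qed.

Lemma comp_ext e j F : below t j -> F \in b -> comp e j F \in a.
Proof.
move=> bj Fb; rewrite [comp e j F]mpolyE big_seq; apply: rpred_sum => u.
rewrite mcoeff_msupp mcoeff_comp -mul_mpolyC => cu; apply: idealMr.
have : zmono u j \in msupp F.
  by rewrite mcoeff_msupp; move: cu; case: ifP; rewrite ?eqxx.
by move=> /(ext_sub Fb); rewrite /ext_mono zmono_max xpart_zmono bj => /negPn.
Qed.

(** f z^j, for f homogeneous of degree e. *)
Definition emb e j (f : A) : B := \sum_(u <- monos n e) f@_u *: 'X_[zmono u j].

Lemma mcoeff_emb e j f m : (emb e j f)@_m =
  if (m ord_max == j) && (mdeg (xpart m) == e) then f@_(xpart m) else 0.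
Proof.
rewrite /emb raddf_sum /=; case: ifP => [/andP[/eqP mj me]|mN].
  have us : xpart m \in monos n e by rewrite mem_monos.
  have mE : zmono (xpart m) j = m by rewrite -mj zmono_xpart.
  rewrite (perm_big _ (perm_to_rem us)) big_cons /= mcoeffZ mcoeffX mE eqxx mulr1.
  rewrite big_seq big1 ?addr0 // => v; rewrite mem_rem_uniq ?monos_uniq //.
  rewrite inE => /andP[vu _]; rewrite mcoeffZ mcoeffX -{1}mE.
  by case: eqP => [/zmono_inj vE|_]; [rewrite vE eqxx in vu | rewrite mulr0].
rewrite big_seq big1 // => v; rewrite mem_monos mcoeffZ mcoeffX => ve.
by case: eqP => [mE|_]; [rewrite -mE zmono_max xpart_zmono eqxx ve in mN | rewrite mulr0].
Qed.

Lemma comp_emb e j e' j' f : f \is e.-homog ->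
  comp e' j' (emb e j f) = if (e' == e) && (j' == j) then f else 0.
Proof.
move=> fe; apply/mpolyP => u.
rewrite mcoeff_comp mcoeff_emb zmono_max xpart_zmono.
have fu : mdeg u != e -> f@_u = 0 by apply: dhomog_nemf_coeff.
case: (e' =P e) => [->|e'e] /=; last first.
  by rewrite mcoeff0; case: (mdeg u =P e') => // ->; move/eqP/negPf: e'e => ->; rewrite andbF.
case: (j' =P j) => _ /=; last by rewrite mcoeff0 if_same.
by case: eqP fu => //= /eqP ue ->.
Qed.

Section NewEmbedding.
Variable L : nat -> nat -> set A.
Hypothesis L_flags : flags a L.
Variable H : nat -> nat.
Hypothesis H_adm : admissible H.

(** The preimage in B of the direct sum, over all degrees d and all j < t, of
    L (d-j) (p j) z^j, with p the segment of total H' d. *)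
Definition seg_space (H' : nat -> nat) : set B := [set F | forall e j, below t j ->
  L e (seg (e + j)%N (H' (e + j)%N) j) (comp e j F)].

Local Notation p d := (seg d (H d)).
Local Notation V := (seg_space H).

Lemma seg_segment d : segment t hdima growtha d (p d).
Proof. by case: (segP (H_adm d).1). Qed.

Lemma seg_total d : total d (p d) = H d.
Proof. by case: (segP (H_adm d).1). Qed.

Lemma seg_hdim e j : (p (e + j)%N j <= hdima e)%N.
Proof. by have := stable_cap j (seg_segment (e + j)%N).1; rewrite addnK. Qed.

Lemma shift_seg d j : (shift t growtha d (p d) j <= p d.+1 j)%N.
Proof.
apply: (segment_mono _ (seg_segment d.+1)); last by rewrite seg_total (H_adm d).2.
exact: shift_segment (@growth0 _ _ a) (@growth_mono _ _ a) g_le _ _ (seg_segment d).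
Qed.

Lemma flag_at_seg e j : [/\ lspace (L e (p (e + j)%N j)),
  forall f, L e (p (e + j)%N j) f -> f \is e.-homog
  & forall f, f \in a -> f \is e.-homog -> L e (p (e + j)%N j) f].
Proof. by case: L_flags => LP _ _ _; apply/LP/seg_hdim. Qed.

Lemma seg_space_lspace : lspace V.
Proof.
split=> [|c F G VF VG] e j bj; have [LS _ _] := flag_at_seg e j.
  rewrite (_ : comp e j 0 = 0); first by case: LS.
  by apply/mpolyP => u; rewrite mcoeff_comp !mcoeff0 if_same.
by rewrite comp_lin; case: LS => _; apply; [apply: VF | apply: VG].
Qed.

(** Multiplication by z: the entry p j of the segment in degree d is at most the
    entry j+1 in degree d+1. Multiplication by x_i: the flag space grows to
    g (p j), which for j = 0 is the first entry of the shift and for j > 0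
    is at most p (j-1), by stability. Both are bounded by [shift_seg]. *)
Lemma seg_space_mulX F i : V F -> V ('X_i * F).
Proof.
move=> VF; have [_ _ L_mono L_grow] := L_flags.
have L0 e j : L e (p (e + j)%N j) 0 by have [[]] := flag_at_seg e j.
elim/ord_maxVwiden: i => [|i] e j bj.
  case: j bj => [|j] bj; first by rewrite comp_z0.
  rewrite comp_zS; apply: (L_mono e (p (e + j)%N j)).
  - by have := shift_seg (e + j)%N j.+1; rewrite addnS /= bj.
  - exact: seg_hdim.
  - exact/VF/(below_leq (leqnSn j)).
case: e => [|e]; first by rewrite comp_x0.
rewrite comp_xS; apply: (L_mono e.+1 (growtha e (p (e + j)%N j))).
- apply: leq_trans (shift_seg (e + j)%N j); case: j bj => [|j] bj.
    by rewrite addn0.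
  by rewrite /shift bj; have := (seg_segment (e + j.+1)%N).1.2 j; rewrite addnK.
- exact: seg_hdim.
- by apply: L_grow; [apply: seg_hdim | apply: VF].
Qed.

Lemma seg_space_homog F d : V F -> V (pihomog mdeg d F).
Proof.
move=> VF e j bj; rewrite comp_pihomog; case: eqP => _; first exact: VF.
by have [[]] := flag_at_seg e j.
Qed.

Lemma seg_space_ext F : F \in b -> V F.
Proof.
move=> Fb e j bj; have [_ _ La] := flag_at_seg e j.
by apply: La (comp_homog _ _ _); apply: comp_ext.
Qed.

(** The space is the direct sum of its coefficient spaces, so that a leading
    monomial of it is z^j times one of the coefficient of z^j. *)
Lemma lead_seg_space u j : below t j ->
  lead_of (piece V (mdeg u + j)%N) (zmono u j) <->
  lead_of (L (mdeg u) (p (mdeg u + j)%N j)) u.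
Proof.
move=> bj; set e := mdeg u; split=> [[F [[VF Fd] F0 lF]]|[f [Lf f0 lf]]].
  have cu : (comp e j F)@_u != 0 by rewrite mcoeff_comp eqxx -lF mleadc_eq0.
  have c0 : comp e j F != 0.
    by apply: contraNneq cu => ->; rewrite mcoeff0.
  exists (comp e j F); split=> //; first exact: VF.
  apply/eqP; rewrite eq_le msupp_le_mlead ?mcoeff_msupp // andbT.
  have := mlead_supp c0; set w := mlead _.
  rewrite mcoeff_msupp mcoeff_comp; case: ifP => _; last by rewrite eqxx.
  by rewrite -mcoeff_msupp => /msupp_le_mlead; rewrite lF; apply: zmono_le.
have fe : f \is e.-homog by have [_ + _] := flag_at_seg e j; apply.
have Fu : (emb e j f)@_(zmono u j) != 0.
  by rewrite mcoeff_emb zmono_max xpart_zmono !eqxx /= -lf mleadc_eq0.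
have F0 : emb e j f != 0 by apply: contraNneq Fu => ->; rewrite mcoeff0.
exists (emb e j f); split=> //.
  split.
    move=> e' j' bj'; rewrite comp_emb //.
    case: (boolP (_ && _)) => [/andP[/eqP -> /eqP ->] //|_].
    by have [[]] := flag_at_seg e' j'.
  apply/dhomogP => m; rewrite mcoeff_msupp mcoeff_emb.
  case: ifP => [/andP[/eqP mj /eqP me] _|]; last by rewrite eqxx.
  have md : mdeg m = (e + j)%N by rewrite -(zmono_xpart m) mdeg_zmono mj me.
  exact: md.
apply/eqP; rewrite eq_le msupp_le_mlead ?mcoeff_msupp // andbT.
have := mlead_supp F0; set w := mlead _; rewrite mcoeff_msupp mcoeff_emb.
case: ifP => [/andP[/eqP wj _]|]; last by rewrite eqxx.
rewrite -mcoeff_msupp => /msupp_le_mlead; rewrite lf => /(zmono_le_mono j).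
by rewrite -wj zmono_xpart.
Qed.

Lemma seg_space_ideal : is_homog_ideal (quot_gr b) [set \pi_{ideal_quot b} F | F in V].
Proof. exact: image_homog_ideal seg_space_lspace seg_space_mulX seg_space_homog. Qed.

Lemma hilb_seg_space : hilb (quot_gr b) [set \pi_{ideal_quot b} F | F in V] = H.
Proof.
apply: funext => d.
rewrite (hilb_image b_mono seg_space_lspace seg_space_mulX seg_space_homog seg_space_ext).
rewrite sum_zmono sum_monosle.
rewrite -[RHS]seg_total; apply: eq_bigr => j _.
have [j_d jE] : (j <= d)%N /\ (d - j + j = d)%N.
  by have := ltn_ord j; rewrite ltnS => j_d; rewrite subnK.
have [bj|bj] := boolP (below t j); last first.
  rewrite (stable_out (seg_segment d).1) ?(negPf bj) ?andbF //.
  rewrite big_seq big1 // => u; rewrite mem_monos => /eqP ue.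
  by rewrite -/(nonzero b _) nonzero_ext ue subKn // (negPf bj) andbF.
have [_ L_dim _ _] := L_flags.
have := seg_hdim (d - j)%N j; rewrite jE => /L_dim L_dj; rewrite -[RHS]L_dj.
rewrite big_seq [RHS]big_seq; apply: eq_bigr => u; rewrite mem_monos => /eqP ue.
rewrite -/(nonzero b _) nonzero_ext ue subKn // bj; congr (nat_of_bool (_ && _)).
have := lead_seg_space u bj; rewrite ue jE => lead_u.
by apply/asboolP/asboolP => /lead_u.
Qed.

End NewEmbedding.

Lemma seg_space_mono (L : nat -> nat -> set A) H H' : flags a L ->
  admissible H -> admissible H' -> le_series H H' ->
  seg_space L H `<=` seg_space L H'.
Proof.
move=> L_flags Ha H'a HH' F VF e j bj; have [_ _ L_mono _] := L_flags.
apply: L_mono (VF e j bj); last exact: seg_hdim.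
apply: (segment_mono (seg_segment Ha _) (seg_segment H'a _)).
by rewrite !seg_total.
Qed.

End Extension.

Theorem theorem3p25 (k : fieldType) (n : nat)
    (t : option nat) (t_gt0 : pos_exponent t)
    (a : idealr {mpoly k[n]})
    (a_monomial : is_monomial_ideal [set` a])
    (a_deg1 : forall f : {mpoly k[n]}, f \in a -> f \is 1.-homog -> f = 0)
    (a_pow : forall i : 'I_n, exprt ('X_i : {mpoly k[n]}) t \in a) :
  admits_embedding (quot_gr a) ->
  admits_embedding (quot_gr (ext_ideal a t_gt0)).
Proof.
have a_mono := monomial_idealP a_monomial.
move=> /(embedding_flags a_mono) [L L_flags].
have adm H := @hilb_admissible _ _ _ t_gt0 _ a_mono a_pow H.
pose eps H := [set \pi_{ideal_quot (ext_ideal a t_gt0)} F | F in seg_space t a L H].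
have eps_hilb H : hilb_series (quot_gr (ext_ideal a t_gt0)) H ->
    hilb (quot_gr (ext_ideal a t_gt0)) (eps H) = H.
  by move=> /adm; apply: hilb_seg_space.
exists eps; split=> //.
- by move=> H /adm; apply: seg_space_ideal.
- move=> H H' /adm Ha /adm H'a HH' _ [F VF <-]; exists F => //.
  exact: seg_space_mono VF.
- by move=> H H' /eps_hilb HE /eps_hilb H'E eps_eq; rewrite -HE eps_eq.
Qed.
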